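(* For every sequence of estimators $\{\widehat{\mathbb B}_n\}$ (each $\widehat{\mathbb B}_n$ being an $L^2[0,1]$-valued function of the data $(y_1,\mathbb X_1),\dots,(y_n,\mathbb X_n)$), $$\liminf_{n\to\infty}\; n^{(2\beta-1)/(\alpha+2\beta)}\sup_{f\in\mathcal F}\mathbb P_{n,f}\|\mathbb B-\widehat{\mathbb B}_n\|^2>0 .$$ Here $\mathcal F=\mathcal F(R,\alpha,\beta)$, $\mathbb B$ is the last component of $f=(K,a,\mu,\mathbb B)$, and $\mathbb P_{n,f}Z$ denotes the expectation of $Z$ under $\mathbb P_{n,f}$.
   Context: Norm and inner product. $\|\cdot\|$ and $\langle\cdot,\cdot\rangle$ are the norm and inner product of $L^2[0,1]$. Exponential family. $\{Q_\lambda:\lambda\in\mathbb R\}$ is a one-parameter exponential family of probability measures on $\mathbb R$ with $dQ_\lambda/dQ_0=f_\lambda(y)=\exp(\lambda y-\psi(\lambda))$ for all $\lambda\in\mathbb R$; thus $\psi(0)=0$, $e^{\psi(\lambda)}=\int e^{\lambda y}\,dQ_0(y)$, and $Q_\lambda$ has mean $\dot\psi(\lambda)$ and variance $\ddot\psi(\lambda)$. It is assumed that $\ddot\psi(\lambda)>0$ for every real $\lambda$ (i.e. the family is non-degenerate), and: (1) for each $\epsilon>0$ there is a finite constant $C_\epsilon$ with $\ddot\psi(\lambda)\le C_\epsilon\exp(\epsilon\lambda^2)$ for all $\lambda\in\mathbb R$; (2) there is an increasing real function $G$ on $\mathbb R^+$, with $G(0)\ge 1$, such that $|\dddot\psi(\lambda+h)|\le\ddot\psi(\lambda)G(|h|)$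 for all $\lambda,h\in\mathbb R$. Parameter set. For real constants $\alpha>1$, $\beta>(\alpha+3)/2$, $R>0$, $\mathcal F=\mathcal F(R,\alpha,\beta)$ is the set of all $f=(K,a,\mu,\mathbb B)$ such that: (K) $K$ is a covariance kernel on $[0,1]^2$, square integrable with respect to Lebesgue measure, with eigenfunction expansion (as a compact operator on $L^2[0,1]$) $K(s,t)=\sum_{k\in\mathbb N}\theta_k\phi_k(s)\phi_k(t)$, with $\{\phi_k\}$ orthonormal and decreasing eigenvalues satisfying $Rk^{-\alpha}\ge\theta_k\ge\theta_{k+1}+(\alpha/R)k^{-\alpha-1}$ for all $k\in\mathbb N$; (a) $a\in\mathbb R$, $|a|\le R$; ($\mu$) $\mu\in L^2[0,1]$, $\|\mu\|\le R$; ($\mathbb B$) $\mathbb B(t)=\sum_{k\in\mathbb N}b_k\phi_k(t)$ with $|b_k|\le Rk^{-\beta}$, for the eigenfunctions $\phi_k$ of $K$. The constants are such that $\mathcal F(R,\alpha,\beta)$ is nonempty. Data. Under $\mathbb P_{n,f}$ the pairs $(y_i,\mathbb X_i)$, $i=1,\dots,n$, are i.i.d.; each $\mathbb X_i=\{\mathbb X_i(t):0\le t\le1\}$ is a Gaussian process with mean $\mu(t)$ and covariance kernel $K(s,t)$; and, conditionally on $\mathbb X_i$, $y_i\sim Q_{\lambda_i}$ with $\lambda_i=a+\langle\mathbb X_i,\mathbb B\rangle$. *)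

(* Defs.v *)
From HB Require Import structures.
From mathcomp Require Import all_boot all_order all_algebra.
From mathcomp Require Import all_classical all_reals all_analysis.

Set Implicit Arguments.
Unset Strict Implicit.
Unset Printing Implicit Defensive.

Import Order.TTheory GRing.Theory Num.Theory.
Import numFieldNormedType.Exports.

Local Open Scope classical_set_scope.
Local Open Scope ring_scope.

Section lebesgue01.
Variable R : realType.

Definition leb01 : set (measurableTypeR R) -> \bar R :=
  mrestr lebesgue_measure (measurable_itv `[(0 : R), 1]).

HB.instance Definition _ := Measure.on leb01.

Let leb01_setT : leb01 [set: measurableTypeR R] = 1%E.
Proof. by rewrite /leb01 /mrestr setTI lebesgue_measure_itv/= lte01 sube0. Qed.

HB.instance Definition _ :=
  Measure_isProbability.Build _ _ R leb01 leb01_setT.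

End lebesgue01.

Section L2_space.
Variable R : realType.

Definition ip01 (f g : R -> R) : R := (\int[@leb01 R]_t (f t * g t))%R.

Definition norm01 (f : R -> R) : R :=
  fine ('N[@leb01 R]_(2%:E)[EFin \o f])%E.

(* Elements of L^2[0,1] are represented by Borel functions on the line that are
   square integrable on [0,1]; their values outside [0,1] play no role. *)
Definition L2fun : Type := LfunType (@leb01 R) (lee1n 2).

HB.instance Definition _ := GRing.Lmodule.on L2fun.
HB.instance Definition _ := isPointed.Build L2fun 0.

(* L^2[0,1] being separable, the sigma-algebra generated by the functionals
   <., h> is its Borel sigma-algebra. *)
Definition L2_cylinders : set (set L2fun) :=
  [set C | exists h : L2fun, exists2 A : set (measurableTypeR R),
     measurable A & C = [set f : L2fun | A (ip01 f h)]].

Definition L2 : Type := g_sigma_algebraType L2_cylinders.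

End L2_space.

Section exponential_family.
Variable R : realType.

Definition exponential_family (Q : R -> probability (measurableTypeR R) R)
    (psi : R -> R) : Prop :=
  forall (lam : R) (A : set (measurableTypeR R)), measurable A ->
    Q lam A = (\int[Q 0%R]_(y in A) (expR (lam * y - psi lam))%:E)%E.

End exponential_family.

Section parameters.
Variable R : realType.

Record param := Param {
  pK : measurableTypeR R * measurableTypeR R -> R;
  pa : R;
  pmu : L2 R;
  pB : L2 R }.

Definition covariance_kernel (K : R * R -> R) : Prop :=
  (forall s t, s \in `[0, 1] -> t \in `[0, 1] -> K (s, t) = K (t, s)) /\
  (forall (m : nat) (t c : 'I_m -> R), (forall i, t i \in `[0, 1]) ->
     0 <= \sum_(i < m) \sum_(j < m) c i * c j * K (t i, t j)).

Definition orthonormal01 (phi : nat -> L2 R) : Prop :=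
  forall j k : nat, ip01 (phi j) (phi k) = (j == k)%:R.

(* K(s,t) = sum_k theta_k phi_k(s) phi_k(t), with convergence in L^2([0,1]^2),
   i.e. in Hilbert-Schmidt norm for the associated integral operators. *)
Definition eigen_expansion (K : measurableTypeR R * measurableTypeR R -> R)
    (theta : nat -> R) (phi : nat -> L2 R) : Prop :=
  (fun N : nat => 'N[@leb01 R \x @leb01 R]_(2%:E)[EFin \o
      (fun p => K p - \sum_(k < N) theta k * phi k p.1 * phi k p.2)%R])%E
    @ \oo --> 0%E.

(* The sequences theta, phi, b are indexed from 0: theta k, phi k, b k stand for
   the eigenvalue, eigenfunction and coefficient of index k.+1. *)
Definition paramF (r alpha beta : R) : set param :=
  [set f : param | exists (theta : nat -> R) (phi : nat -> L2 R) (b : nat -> R),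
    (covariance_kernel (pK f) /\
     pK f \in Lfun (@leb01 R \x @leb01 R)%E 2%:E /\
     orthonormal01 phi /\
     eigen_expansion (pK f) theta phi /\
     (forall k : nat, theta k <= r * k.+1%:R `^ (- alpha)) /\
     (forall k : nat,
        theta k.+1 + alpha / r * k.+1%:R `^ (- alpha - 1) <= theta k)) /\
    `|pa f| <= r /\
    norm01 (pmu f) <= r /\
    ((fun N : nat => norm01 (pB f \- (fun t => \sum_(k < N) b k * phi k t)))
       @ \oo --> (0 : R)) /\
    (forall k : nat, `|b k| <= r * k.+1%:R `^ (- beta))].

End parameters.

Section gaussian.
Variable R : realType.

(* [normal_prob m 0] is not the degenerate normal law at m, hence the case
   distinction. *)
Definition normal_law d (Omega : measurableType d) (P : probability Omega R)
    (Z : Omega -> R) (m s : R) : Prop :=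
  forall A : set (measurableTypeR R), measurable A ->
    P (Z @^-1` A) = if s == 0 then \d_m A else normal_prob m s A.

Definition gaussian_process01 d (Omega : measurableType d)
    (P : probability Omega R) (X : Omega -> R -> R) : Prop :=
  forall (m : nat) (t c : 'I_m -> R), (forall i, t i \in `[0, 1]) ->
    exists mean sd : R,
      normal_law P (fun w => \sum_(i < m) c i * X w (t i)) mean sd.

(* [Gamma] is the law, on L^2[0,1], of a measurable Gaussian process with mean
   [mu] and covariance kernel [K].  Since [mu] and [K] are only meant as elements
   of L^2[0,1] and L^2([0,1]^2), the mean and covariance functions of the process
   are required to agree with them almost everywhere. *)
Definition gaussian_process_law (Gamma : probability (L2 R) R) (mu : L2 R)
    (K : measurableTypeR R * measurableTypeR R -> R) : Prop :=
  exists (d : measure_display) (Omega : measurableType d)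
         (P : probability Omega R) (X : Omega -> L2 R),
    measurable_fun [set: Omega * measurableTypeR R]
      (fun p : Omega * measurableTypeR R => X p.1 p.2 : measurableTypeR R) /\
    gaussian_process01 P (fun w => X w) /\
    {ae @leb01 R, forall t, 'E_P[fun w => X w t] = (mu t)%:E}%E /\
    {ae (@leb01 R \x @leb01 R)%E, forall p,
       covariance P (fun w => X w p.1) (fun w => X w p.2) = (K p)%:E} /\
    (forall S : set (L2 R), measurable S -> Gamma S = P (X @^-1` S)).

End gaussian.

Section data.
Variable R : realType.

(* One observation is a pair (y_i, X_i). *)
Definition obs : Type := (measurableTypeR R * L2 R)%type.

Definition sample_law (Q : R -> probability (measurableTypeR R) R)
    (Gamma : probability (L2 R) R) (a : R) (B : L2 R)
    (n : nat) (P : probability (n.-tuple obs) R) : Prop :=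
  (forall E : 'I_n -> set obs, (forall i, measurable (E i)) ->
     P [set z | forall i, E i (tnth z i)] =
     (\prod_(i < n) P [set z | E i (tnth z i)])%E) /\
  (forall (i : 'I_n) (S : set (L2 R)), measurable S ->
     P [set z | S (tnth z i).2] = Gamma S) /\
  (* conditionally on X_i, y_i has law Q_lambda, lambda = a + <X_i, B> *)
  (forall (i : 'I_n) (A : set (measurableTypeR R)) (S : set (L2 R)),
     measurable A -> measurable S ->
     P [set z | A (tnth z i).1 /\ S (tnth z i).2] =
     (\int[P]_(z in [set z | S (tnth z i).2])
        Q (a + ip01 (tnth z i).2 B)%R A)%E).

End data.

(* Main.v *)
(* Assouad's argument on a hypercube of slope functions.  Keep the covariance
   kernel of some member of the parameter set, put mean and intercept to zero, and
   let B_g be the sum of delta g_i phi_(m+i) over i < m, for g in {0,1}^m, with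
   delta of order m^-beta.  When B = 0 the response is independent of X, so the
   corresponding product law dominates all the others and the densities are
   explicit.  Two vertices that differ in one coordinate have linear predictors that
   differ by delta <X, phi_k>, whose second moment is delta^2 theta_k.  On the event
   that both predictors lie in [-1, 1] the squared Hellinger distance of the
   responses is at most a constant times the squared difference; the complement has
   probability O(|B_g|^4) by a fourth moment bound for the Gaussian process.  The
   affinity per observation is therefore at least
   1 - C (delta^2 m^-alpha + (m delta^2)^2), and beta > (alpha + 3)/2 makes the last
   term negligible.  For m of order n^(1/(alpha + 2 beta)) the affinity of n
   observations stays bounded away from zero, so that each of the m coordinates
   costs a constant times delta^2. *)

Require Import Defs.
From HB Require Import structures.
From mathcomp Require Import all_boot all_order all_algebra.
From mathcomp Require Import all_classical all_reals all_analysis.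
From mathcomp Require Import measurable_realfun.
From mathcomp Require Import ring lra.

Set Implicit Arguments.
Unset Strict Implicit.
Unset Printing Implicit Defensive.

Import Order.TTheory GRing.Theory Num.Theory.
Import numFieldNormedType.Exports.

Local Open Scope classical_set_scope.
Local Open Scope ring_scope.

(** * Measures with a density *)

(** The Gaussian hypothesis concerns linear combinations of finitely many values of the process, and
    its mean and covariance are tied to [mu] and [K] only almost everywhere. So <X, h> is not known
    to be Gaussian, and the diagonal of [K] says nothing about the variances of X(t). The estimates
    on X therefore start from one fact about single values: the fourth moment of X(t) is at most a
    universal multiple of its squared second moment. Because the paths lie in L^2, this makes the
    second moment integrable in t. A weighted fourth moment then bounds the tail of <X, h> by a
    multiple of ||h||^4, and the same integrability justifies the Fubini argument that identifies E
    <X, phi_k>^2 with theta_k. On the response side the densities and their square roots are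
    exponentials in y, so affinities are expressed through exp psi, and bounds on exp psi come from
    integrating elementary inequalities in y against [Q 0] rather than from derivatives. *)

Section density.
Context d (T : measurableType d) (R : realType).
Variables (mu : {measure set T -> \bar R}) (w : T -> R).
Hypotheses (mw : measurable_fun [set: T] w) (w0 : forall x, 0 <= w x).

Definition density_measure (A : set T) : \bar R := (\int[mu]_(x in A) (w x)%:E)%E.

Let dens0 : density_measure set0 = 0%E.
Proof. exact: integral_set0. Qed.

Let dens_ge0 A : (0 <= density_measure A)%E.
Proof. by apply: integral_ge0 => x _; rewrite lee_fin. Qed.

Let dens_sigma_additive : semi_sigma_additive density_measure.
Proof.
move=> F mF tF mUF; rewrite /density_measure ge0_integral_bigcup//=.
  by apply: is_cvg_ereal_nneg_natsum_cond => n _ _; exact: dens_ge0.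
- exact/measurable_EFinP/measurable_funTS.
- by move=> x _; rewrite lee_fin.
Qed.

HB.instance Definition _ := isMeasure.Build _ _ _ density_measure
  dens0 dens_ge0 dens_sigma_additive.

Import HBNNSimple.

(** Indicators, then simple functions, then monotone convergence along the approximation
    [nnsfun_approx]. *)
Lemma integral_density_measure (g : T -> \bar R) :
  measurable_fun setT g -> (forall x, (0 <= g x)%E) ->
  (\int[density_measure]_x g x = \int[mu]_x (g x * (w x)%:E))%E.
Proof.
move=> mg g0; pose g_ := nnsfun_approx measurableT mg.
have cvg_g x : (EFin \o g_^~ x) n @[n --> \oo] --> g x by exact: cvg_nnsfun_approx.
have ind A : measurable A ->
    (\int[density_measure]_x (\1_A x)%:E = \int[mu]_x ((\1_A x)%:E * (w x)%:E))%E.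
  move=> mA; rewrite integral_indic// setIT.
  rewrite [LHS](integral_mkcond A (EFin \o w)).
  apply: eq_integral => x _; rewrite patchE indicE.
  by case: ifP => xA; rewrite ?mul1e ?mul0e.
have sfun (h : {nnsfun T >-> R}) :
    (\int[density_measure]_x (h x)%:E = \int[mu]_x ((h x)%:E * (w x)%:E))%E.
  under [LHS]eq_integral do rewrite fimfunE -fsumEFin//.
  rewrite [LHS]ge0_integral_fsum//; last 2 first.
  - by move=> r; apply/measurable_EFinP; do 2 apply/measurableT_comp => //.
  - by move=> n x _; rewrite EFinM nnfun_muleindic_ge0.
  transitivity (\int[mu]_x ((\sum_(r \in range h) (r * \1_(h @^-1` [set r]) x)%:E) * (w x)%:E))%E;
    last first.
    apply: eq_integral => x _; congr (_ * _)%E.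
    by rewrite [in RHS]fimfunE -fsumEFin.
  under [RHS]eq_integral.
    move=> x xD; rewrite ge0_mule_fsuml; last first.
      by move=> r; rewrite EFinM nnfun_muleindic_ge0.
    over.
  rewrite [RHS]ge0_integral_fsum//; last 2 first.
  - move=> r; apply: emeasurable_funM; last exact/measurable_EFinP.
    by apply/measurable_EFinP; do 2 apply/measurableT_comp => //.
  - by move=> n x _; rewrite mule_ge0//; [rewrite EFinM nnfun_muleindic_ge0|rewrite lee_fin].
  apply: eq_fsbigr => r /[!inE] -[t _ <-].
  rewrite integralZl_indic_nnsfun//= ind// -ge0_integralZl//.
  - by apply: eq_integral => x _; rewrite EFinM muleA.
  - by apply: emeasurable_funM; exact/measurable_EFinP.
  - by move=> x _; rewrite mule_ge0 ?lee_fin.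
  - by rewrite lee_fin.
have nd x : {homo (fun n => (g_ n x)%:E) : n m / (n <= m)%N >-> (n <= m)%E}.
  by move=> m n mn; rewrite lee_fin; exact/lefP/nd_nnsfun_approx.
transitivity (limn (fun n => \int[density_measure]_x (g_ n x)%:E)%E).
  rewrite -monotone_convergence//.
  - by apply: eq_integral => y _; apply/esym/cvg_lim => //; exact: cvg_g.
  - by move=> n; exact/measurable_EFinP/measurable_funP.
  - by move=> n y _; rewrite lee_fin.
transitivity (limn (fun n => \int[mu]_x ((g_ n x)%:E * (w x)%:E))%E).
  by congr (limn _); apply/funext => n; rewrite sfun.
rewrite -monotone_convergence//.
- apply: eq_integral => y _; apply/cvg_lim => //.
  by apply: cvgeZr => //; exact: cvg_g.
- move=> n; apply: emeasurable_funM; apply/measurable_EFinP => //.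

- by move=> n y _; rewrite mule_ge0 ?lee_fin.
- by move=> y _ m n mn; rewrite lee_wpmul2r ?lee_fin//; exact/lefP/nd_nnsfun_approx.
Qed.

Lemma exists_density : exists nu : {measure set T -> \bar R},
  (forall A, nu A = \int[mu]_(x in A) (w x)%:E)%E /\
  (forall g : T -> \bar R, measurable_fun [set: T] g -> (forall x, (0 <= g x)%E) ->
   (\int[nu]_x g x = \int[mu]_x (g x * (w x)%:E))%E).
Proof. by exists density_measure; split=> //; exact: integral_density_measure. Qed.

End density.

(** * Product measures on tuples *)

Section tuples.
Context d (T : measurableType d) (R : realType) (n : nat).

Definition rectangle (E : 'I_n -> set T) : set (n.-tuple T) :=
  [set z | forall i, E i (tnth z i)].

Lemma measurable_rectangle (E : 'I_n -> set T) :
  (forall i, measurable (E i)) -> measurable (rectangle E).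
Proof.
move=> mE; rewrite (_ : rectangle E = \big[setI/setT]_(i < n) ((@tnth n T)^~ i @^-1` E i)).
  apply: bigsetI_measurable => i _.
  by rewrite -[X in measurable X]setTI; exact: measurable_tnth.
rewrite -bigcap_seq; apply/seteqP; split=> z /= zE i /=; first by move=> _; exact: zE.
by apply: (zE i); rewrite /= mem_index_enum.
Qed.

(** Rectangles are stable under intersection and generate the sigma-algebra of tuples: the preimage
    of [B] under coordinate [i] is the rectangle whose sides are all full except side [i]. *)
Lemma tuple_measure_unique (m1 m2 : {measure set (n.-tuple T) -> \bar R}) :
  (forall E, (forall i, measurable (E i)) -> m1 (rectangle E) = m2 (rectangle E)) ->
  (m1 setT < +oo)%E -> forall A, measurable A -> m1 A = m2 A.
Proof.
move=> m12 m1T.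
pose G := [set C | exists2 E : 'I_n -> set T, (forall i, measurable (E i)) & C = rectangle E].
have GT : G setT.
  by exists (fun=> setT) => //; apply/seteqP; split.
apply: (measure_unique G (fun=> setT)) => //.
- apply/seteqP; split; last first.
    apply: smallest_sub; first exact: sigma_algebra_measurable.
    by move=> _ [E mE ->]; exact: measurable_rectangle.
  apply: smallest_sub; first exact: smallest_sigma_algebra.
  move=> A; rewrite -bigcup_seq => -[i _ [B mB <-]].
  apply: sub_sigma_algebra; exists (fun j => if j == i then B else setT).
    by move=> j; case: ifP.
  apply/seteqP; split=> z /=.
    by move=> [_ Bz] j; case: eqP => // ->.
  by move=> /(_ i); rewrite eqxx.
- move=> _ _ [E mE ->] [F mF ->]; exists (fun i => E i `&` F i).
    by move=> i; exact: measurableI.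
  by apply/seteqP; split=> z /= => [[Ez Fz] i|EFz]; [split|split=> i; have [] := EFz i].
- by apply/seteqP; split=> // z _; exists 0%N.
- by move=> _ [E mE ->]; exact: m12.
Qed.

Lemma measurable_tuple_prod (g : 'I_n -> T -> R) (Q : pred 'I_n) :
  (forall i, measurable_fun [set: T] (g i)) ->
  measurable_fun [set: n.-tuple T] (fun z => \prod_(i | Q i) g i (tnth z i)).
Proof.
move=> mg.
under eq_fun do rewrite big_mkcond/=.
apply: measurable_prod => i _; case: (Q i) => //.
by apply: measurableT_comp => //; exact: measurable_tnth.
Qed.

Variables (P : probability (n.-tuple T) R) (nu : probability T R).
Hypothesis PE : forall E : 'I_n -> set T, (forall i, measurable (E i)) ->
  P (rectangle E) = (\prod_(i < n) nu (E i))%E.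

(** [P] is known on rectangles only, which is the case where every factor is an indicator. Factors
    are then freed one coordinate at a time. If all but one are understood, weight [P] by their
    product and push the result to the remaining coordinate: testing with indicators shows that this
    measure is a multiple of [nu], and integrating the last factor against it concludes. *)
Lemma integral_tuple_prod (g : 'I_n -> T -> R) (c : 'I_n -> R) :
  (forall i, measurable_fun [set: T] (g i)) -> (forall i x, 0 <= g i x) ->
  (forall i, (\int[nu]_x (g i x)%:E = (c i)%:E)%E) ->
  (\int[P]_z (\prod_(i < n) g i (tnth z i))%:E = (\prod_(i < n) c i)%:E)%E.
Proof.
(* Induction on [k]: factors of index below [k] are arbitrary, those of index at least [k] are
   indicators. *)
suff H (k : nat) : forall (g : 'I_n -> T -> R) (c : 'I_n -> R), (forall i, measurable_fun [set: T] (g i)) -> (forall i x, 0 <= g i x) ->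
  (forall i, (\int[nu]_x (g i x)%:E = (c i)%:E)%E) ->
  (forall i : 'I_n, (k <= i)%N -> exists2 E, measurable E & g i = \1_E) ->
  (\int[P]_z (\prod_(i < n) g i (tnth z i))%:E = (\prod_(i < n) c i)%:E)%E.
  by move=> mg g0 gc; apply: (H n) => // i; rewrite leqNgt ltn_ord.
elim: k => [|k IH] {}g {}c mg g0 gc gE.
  have /choice[E HE] : forall i, exists E, measurable E /\ g i = \1_E.
    by move=> i; have [E ? ?] := gE i isT; exists E.
  have mE i : measurable (E i) by have [] := HE i.
  have gEi i : g i = \1_(E i) by have [] := HE i.
  transitivity (\int[P]_z (\1_(rectangle E) z)%:E)%E.
    apply: eq_integral => z _; congr (_%:E); rewrite indicE.
    have [/set_mem zE|/negP zE] := boolP (z \in rectangle E).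
      by rewrite big1// => i _; rewrite gEi indicE mem_set.
    apply/eqP; rewrite prodf_seq_eq0; apply/hasP.
    apply: contra_notP zE => h; apply/mem_set => i.
    apply: contra_notP h => h; exists i; rewrite ?mem_index_enum//=.
    by rewrite gEi indicE memNset.
  transitivity (P (rectangle E)).
    by rewrite integral_indic ?setIT//; exact: measurable_rectangle.
  rewrite PE// -prodEFin; apply: eq_bigr => i _.
  by rewrite -gc gEi integral_indic ?setIT.
have [kn|nk] := ltnP k n; last first.
  by apply: IH => // i ki; have := ltn_ord i; rewrite ltnNge (leq_trans nk).
pose i0 := Ordinal kn.
pose W (z : n.-tuple T) := \prod_(i < n | i != i0) g i (tnth z i).
pose C := \prod_(i < n | i != i0) c i.
have c0 i : 0 <= c i.
  by rewrite -lee_fin -gc; apply: integral_ge0 => x _; rewrite lee_fin.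
have C0 : 0 <= C by apply: prodr_ge0.
have mW : measurable_fun [set: n.-tuple T] W by exact: measurable_tuple_prod.
have W0 z : 0 <= W z by apply: prodr_ge0.
have [nu1 [nu1E nu1I]] := exists_density P mW W0.
have mt := @measurable_tnth _ T n i0.
(* The induction hypothesis applies because the factor at [i0] has been replaced by the indicator of
   [A]. *)
have pE A : measurable A ->
    (pushforward nu1 ((@tnth n T)^~ i0) A = mscale (NngNum C0) nu A)%E.
  move=> mA; rewrite /pushforward nu1E.
  have mA' : measurable ((@tnth n T)^~ i0 @^-1` A).
    by rewrite -[X in measurable X]setTI; exact: mt.
  transitivity (\int[P]_z (\prod_(i < n) (if i == i0 then \1_A else g i) (tnth z i))%:E)%E.
    rewrite integral_mkcond; apply: eq_integral => z _.
    rewrite (bigD1 i0)//= eqxx patchE indicE/=.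
    have -> : (z \in [set x | A (tnth x i0)]) = (tnth z i0 \in A).
      by apply/idP/idP => /set_mem h; apply/mem_set.
    case: ifP => _; rewrite ?mul0r// mul1r; congr (_%:E).
    by apply: eq_bigr => i /negbTE ->.
  rewrite (IH (fun i => if i == i0 then \1_A else g i) (fun i => if i == i0 then fine (nu A) else c i)).
  - rewrite (bigD1 i0)//= eqxx (eq_bigr c); last by move=> i /negbTE ->.
    by rewrite EFinM fineK ?fin_num_measure// muleC.
  - by move=> i; case: ifP.
  - by move=> i x; case: ifP.
  - move=> i; case: ifP => // _.
    by rewrite integral_indic// setIT fineK ?fin_num_measure.
  - move=> i ki; case: ifPn => [_|ii0]; first by exists A.
    apply: gE; rewrite ltn_neqAle ki andbT eq_sym.
    by apply: contra ii0 => /eqP h; apply/eqP/val_inj.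
transitivity (\int[nu1]_z (g i0 (tnth z i0))%:E)%E.
  rewrite nu1I//.
  - apply: eq_integral => z _; rewrite -EFinM; congr (_%:E).
    by rewrite (bigD1 i0).
  - by apply/measurable_EFinP; exact: measurableT_comp.
  - by move=> z; rewrite lee_fin.
rewrite -[LHS](ge0_integral_pushforward mt nu1 (D := setT) (f := fun x => (g i0 x)%:E))//.
- rewrite (eq_measure_integral (mscale (NngNum C0) nu)); last by move=> A mA _; exact: pE.
  rewrite ge0_integral_mscale//.
  + by rewrite gc -EFinM [in RHS](bigD1 i0)//= mulrC.
  + exact/measurable_EFinP.
  + by move=> x _; rewrite lee_fin.
- exact/measurable_EFinP.
- by move=> x _; rewrite lee_fin.
Qed.

(** The product of the [f]s is a density of [P'] with respect to [P]: on a rectangle both measures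
    factor, by [integral_tuple_prod] for the functions [f * \1_(E i)], and rectangles determine a
    finite measure. *)
Lemma tuple_change_of_measure (P' : probability (n.-tuple T) R) (f : T -> R)
    (g : n.-tuple T -> \bar R) :
  measurable_fun [set: T] f -> (forall x, 0 <= f x) ->
  (\int[nu]_x (f x)%:E < +oo)%E ->
  (forall E, (forall i, measurable (E i)) ->
     P' (rectangle E) = (\prod_(i < n) \int[nu]_(x in E i) (f x)%:E)%E) ->
  measurable_fun [set: n.-tuple T] g -> (forall z, (0 <= g z)%E) ->
  (\int[P']_z g z = \int[P]_z (g z * (\prod_(i < n) f (tnth z i))%:E))%E.
Proof.
move=> mf f0 fi P'E mg g0.
have mL : measurable_fun [set: n.-tuple T] (fun z => \prod_(i < n) f (tnth z i)).
  exact: (@measurable_tuple_prod (fun=> f) xpredT).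
have L0 (z : n.-tuple T) : 0 <= \prod_(i < n) f (tnth z i) by exact: prodr_ge0.
have [nu1 [nu1E nu1I]] := exists_density P mL L0.
rewrite -nu1I//; apply: eq_measure_integral => A mA _.
apply: tuple_measure_unique => //; last first.
  by apply: (@le_lt_trans _ _ 1%E); [exact: probability_le1|rewrite ltry].
move=> E mE; rewrite -[LHS]/(P' (rectangle E)) P'E// nu1E integral_mkcond.
transitivity (\int[P]_z (\prod_(i < n) (fun x => f x * \1_(E i) x) (tnth z i))%:E)%E; last first.
  apply: eq_integral => z _; rewrite patchE /=.
  case: ifPn => zE.
    move/set_mem: zE => zE.
    by congr (_%:E); apply: eq_bigr => i _; rewrite indicE mem_set ?mulr1//; exact: zE.
  congr (_%:E); apply/eqP; rewrite prodf_seq_eq0; apply/hasP.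
  move/negP: zE; apply: contra_notP => h; apply/mem_set => i.
  apply: contra_notP h => h; exists i; rewrite ?mem_index_enum//=.
  by rewrite indicE memNset// mulr0.
have intE i : (\int[nu]_x (f x * \1_(E i) x)%:E = \int[nu]_(x in E i) (f x)%:E)%E.
  rewrite [RHS]integral_mkcond; apply: eq_integral => x _; rewrite patchE indicE.
  by case: ifP => _; rewrite ?mulr1 ?mulr0.
have fin i : (\int[nu]_(x in E i) (f x)%:E)%E \is a fin_num.
  rewrite ge0_fin_numE; last by apply: integral_ge0 => x _; rewrite lee_fin.
  apply: le_lt_trans fi; apply: ge0_subset_integral => //.
    exact/measurable_EFinP.
  by move=> x _; rewrite lee_fin.
rewrite (@integral_tuple_prod (fun i x => f x * \1_(E i) x) (fun i => fine (\int[nu]_(x in E i) (f x)%:E)))//.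
- by rewrite -prodEFin; apply: eq_bigr => i _; rewrite fineK.
- by move=> i; apply: measurable_funM.
- by move=> i x; rewrite mulr_ge0.
- by move=> i; rewrite intE fineK.
Qed.

End tuples.

(** * Exponential families *)

Section expo.
Variable R : realType.

Lemma sqr_le_expR (y : R) : y ^+ 2 <= 4 * expR `|y|.
Proof.
have h : 1 + `|y| / 2 <= expR (`|y| / 2) by exact: expR_ge1Dx.
have -> : expR `|y| = expR (`|y| / 2) ^+ 2.
  by rewrite expr2 -expRD -splitr.
have y0 := normr_ge0 y.
rewrite -(real_normK (num_real y)).
nra.
Qed.

Lemma expR_norm_le (y : R) : expR `|y| <= expR y + expR (- y).
Proof.
by case: (ger0P y) => _; rewrite ?lerDl ?lerDr expR_ge0.
Qed.

(** For [a <= b], the inequality [1 + x <= expR x] at [x = a - b] gives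
    [expR b - expR a <= expR b * (b - a)], which stands in for the mean value theorem. *)
Lemma expR_lipschitz (a b c : R) : `|a| <= c -> `|b| <= c ->
  (expR a - expR b) ^+ 2 <= (a - b) ^+ 2 * expR (2 * c).
Proof.
wlog ab : a b / a <= b.
  move=> H ac bc; have [ab|/ltW ba] := leP a b; first exact: H.
  by rewrite -sqrrN opprB -[X in _ <= X * _]sqrrN opprB; exact: H.
move=> ac bc.
have h : 1 + (a - b) <= expR (a - b) by exact: expR_ge1Dx.
have h2 : expR a = expR b * expR (a - b) by rewrite -expRD addrCA subrr addr0.
have bc' : expR b <= expR c by rewrite ler_expR (le_trans (ler_norm _)).
have b0 := expR_gt0 b.
have -> : expR (2 * c) = expR c ^+ 2 by rewrite mulrDl mul1r expRD expr2.
have h3 : 0 <= expR b - expR a by rewrite subr_ge0 ler_expR.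
have h4 : expR b - expR a <= expR b * (b - a) by rewrite h2; nra.
have h5 : expR b * (b - a) <= expR c * (b - a) by rewrite ler_wpM2r// subr_ge0.
rewrite -sqrrN opprB -[X in _ <= X * _]sqrrN opprB -exprMn.
apply: lerXn2r; rewrite ?nnegrE//; last by rewrite mulrC (le_trans h4).
by rewrite mulr_ge0 ?expR_ge0// subr_ge0.
Qed.

Variables (Q : R -> probability (measurableTypeR R) R) (psi : R -> R).
Hypothesis hQ : exponential_family Q psi.

(** This is the total mass of [Q l], so all exponential moments of [Q 0] are finite by the very
    definition of the family. *)
Lemma expfam_mgf (l : R) :
  (\int[Q 0%R]_y (expR (l * y))%:E = (expR (psi l))%:E)%E.
Proof.
have := hQ l measurableT; rewrite probability_setT => h.
rewrite -[RHS]mule1 h -ge0_integralZl//.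
- by apply: eq_integral => y _; rewrite -EFinM -expRD addrC subrK.
- apply/measurable_EFinP; apply: measurableT_comp => //.
  by apply: measurable_funB => //; exact: measurable_funM.
Qed.

Lemma expfam_integralD (I : Type) (s : seq I) (a l : I -> R) :
  (forall i, 0 <= a i) ->
  (\int[Q 0%R]_y (\sum_(i <- s) a i * expR (l i * y))%:E =
   (\sum_(i <- s) a i * expR (psi (l i)))%:E)%E.
Proof.
move=> a0; under eq_integral do rewrite -sumEFin.
have m i : measurable_fun [set: measurableTypeR R] (fun y : R => (expR (l i * y))%:E).
  by apply/measurable_EFinP; apply: measurableT_comp => //; exact: measurable_funM.
rewrite ge0_integral_sum//.
- rewrite -sumEFin; apply: eq_bigr => i _.
  under eq_integral do rewrite EFinM.
  rewrite ge0_integralZl//; last by rewrite lee_fin.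
  by rewrite EFinM; congr (_ * _)%E; exact: expfam_mgf.
- by move=> i; under eq_fun do rewrite EFinM; exact: measurable_funeM.
- by move=> i y _; rewrite lee_fin mulr_ge0// expR_ge0.
Qed.

(** Integrates a pointwise inequality between exponential sums in [y] against [Q 0]. Each bound on
    exp psi below is an elementary inequality passed through this lemma, with a short list of
    naturals as index set. *)
Lemma expfam_le (I : Type) (s t : seq I) (a l b k : I -> R) :
  (forall i, 0 <= a i) -> (forall i, 0 <= b i) ->
  (forall y, \sum_(i <- s) a i * expR (l i * y) <= \sum_(i <- t) b i * expR (k i * y)) ->
  \sum_(i <- s) a i * expR (psi (l i)) <= \sum_(i <- t) b i * expR (psi (k i)).
Proof.
move=> a0 b0 h; rewrite -lee_fin -(expfam_integralD s l a0) -(expfam_integralD t k b0).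
have m u v (w : seq I) : measurable_fun [set: measurableTypeR R]
    (fun y : R => (\sum_(i <- w) u i * expR (v i * y))%:E).
  apply/measurable_EFinP; apply: measurable_sum => i.
  apply: measurable_funM => //; apply: measurableT_comp => //.
apply: ge0_le_integral => //.
- by move=> y _; rewrite lee_fin sumr_ge0// => i _; rewrite mulr_ge0// expR_ge0.
- by move=> y _; rewrite lee_fin.
Qed.

(** [psi] is the logarithm of a parameter integral, which is measurable by Tonelli. *)
Lemma measurable_expfam_psi : measurable_fun [set: measurableTypeR R] (psi : _ -> measurableTypeR R).
Proof.
have -> : psi = (fun l => ln (fine (\int[Q 0%R]_y (expR (l * y))%:E)))%E.
  by apply/funext => l; rewrite expfam_mgf/= expRK.
apply: measurableT_comp => //.
apply: measurableT_comp; first exact: fine_measurable.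
apply: (@measurable_fun_fubini_tonelli_F _ _ _ _ _ (Q 0)
  (fun p : measurableTypeR R * measurableTypeR R => (expR (p.1 * p.2))%:E)).
- apply/measurable_EFinP; apply: measurableT_comp => //.
  by apply: measurable_funM.
- by move=> p; rewrite lee_fin expR_ge0.
Qed.

(* Hellinger affinity; the bound amounts to local boundedness of the second
   derivative of [exp psi], which is the moment generating function of [Q 0]. *)
Lemma expfam_affinity_ge : exists2 C, 0 < C & forall l k, `|l| <= 1 -> `|k| <= 1 ->
  1 - C * (l - k) ^+ 2 <= expR (psi ((l + k) / 2) - (psi l + psi k) / 2).
Proof.
pose M l := expR (psi l).
have M0 l : 0 < M l by exact: expR_gt0.
have Mle l : `|l| <= 1 -> M l <= M 1 + M (- 1).
  move=> l1.
  have := @expfam_le nat [:: 0] [:: 0; 1]%N (fun=> 1) (fun=> l) (fun=> 1)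
    (fun i => if i == 0 then 1 else - 1).
  rewrite !big_cons !big_nil/= !mul1r !addr0; apply => // y.
  rewrite !big_cons !big_nil/= !mul1r !addr0 mulN1r.
  apply: le_trans (expR_norm_le y).
  rewrite ler_expR (le_trans (ler_norm _))// normrM ler_piMl//.
(* Cauchy-Schwarz in disguise: integrate [2 <= u + u^-1] with [u = M (- l) * expR (l * y)]. Together
   with [Mle] it bounds [M] from below on [-1, 1]. *)
have Mge l : 1 <= M l * M (- l).
  have := @expfam_le nat [:: 0] [:: 0; 1]%N (fun=> 2) (fun=> 0)
    (fun i => if i == 0 then M (- l) else (M (- l))^-1)
    (fun i => if i == 0 then l else - l).
  rewrite !big_cons !big_nil/= !addr0 -/(M l) -/(M (- l)) -/(M 0).
  rewrite mulVf ?gt_eqF//.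
  have -> : M 0 = 1.
    apply: EFin_inj; rewrite -expfam_mgf.
    under eq_integral do rewrite mul0r expR0.
    by rewrite integral_cst// mul1e; exact: probability_setT.
  suff h y : 2 * expR (0 * y) <=
     M (- l) * expR (l * y) + (M (- l))^-1 * expR (- l * y).
    move=> H; have {H} := H _ _ _.
    rewrite mulr1 => H.
    suff : 2 <= M (- l) * M l + 1 by move=> {H} ?; lra.
    apply: H => [//|i|y].
      by case: ifP; rewrite ?invr_ge0 ltW.
    by rewrite !big_cons !big_nil/= !addr0.
  rewrite mul0r expR0 mulr1.
  have -> : - l * y = - (l * y) by rewrite mulNr.
  rewrite expRN; set e := expR _; set m := M _.
  have e0 : 0 < e by exact: expR_gt0.
  have me0 : 0 < m * e by apply: mulr_gt0 => //; exact: M0.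
  rewrite -invfM.
  rewrite -(ler_pM2r me0) [leRHS]mulrDl mulVf ?gt_eqF//.
  move: (m * e) => u; have := sqr_ge0 (u - 1); nra.
pose K := M 2 + M (- 2).
have K0 : 0 < K by rewrite addr_gt0.
pose D := M 1 + M (- 1).
have D0 : 0 < D by rewrite addr_gt0.
(* The second difference of [M] is the integral of the square of
   [expR (l * y / 2) - expR (k * y / 2)]. That square is at most [(l - k)^2 * (y^2 / 4) * expR |y|],
   hence at most [(l - k)^2 * expR (2 * |y|)], which explains [K]. *)
have M2 l k : `|l| <= 1 -> `|k| <= 1 ->
    M l + M k <= 2 * M ((l + k) / 2) + K * (l - k) ^+ 2.
  move=> l1 k1.
  have := @expfam_le nat [:: 0; 1]%N [:: 0; 1; 2]%N (fun=> 1)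
    (fun i => if i == 0 then l else k)
    (fun i => if i == 0 then 2 else (l - k) ^+ 2)
    (fun i => if i == 0 then (l + k) / 2 else if i == 1%N then 2 else - 2).
  rewrite !big_cons !big_nil/= !addr0 !mul1r.
  rewrite -/(M l) -/(M k) -/(M _) -/(M 2) -/(M (- 2)) -mulrDr -/K [K * _]mulrC.
  apply => // [i|y].
    by case: ifP => // _; rewrite sqr_ge0.
  rewrite !big_cons !big_nil/= !addr0 !mul1r -mulrDr.
  have hl : `|l * y / 2| <= `|y| / 2.
    rewrite normrM [`|2^-1|]ger0_norm ?invr_ge0// ler_pM2r ?invr_gt0//.
    by rewrite normrM ler_piMl.
  have hk : `|k * y / 2| <= `|y| / 2.
    rewrite normrM [`|2^-1|]ger0_norm ?invr_ge0// ler_pM2r ?invr_gt0//.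
    by rewrite normrM ler_piMl.
  have := expR_lipschitz hl hk.
  have -> : expR (l * y) = expR (l * y / 2) ^+ 2 by rewrite expr2 -expRD -splitr.
  have -> : expR (k * y) = expR (k * y / 2) ^+ 2 by rewrite expr2 -expRD -splitr.
  have -> : expR ((l + k) / 2 * y) = expR (l * y / 2) * expR (k * y / 2).
    by rewrite -expRD; congr expR; field.
  have -> : 2 * (`|y| / 2) = `|y| by field.
  have -> : l * y / 2 - k * y / 2 = (l - k) * y / 2 by field.
  have h1 := sqr_le_expR y.
  have h2 : expR `|y| * expR `|y| <= expR (2 * y) + expR (- 2 * y).
    have := expR_norm_le (2 * y); rewrite normrM (@ger0_norm _ 2)// -mulNr.
    by rewrite -expRD [in 2 * _]mulrDl mul1r.
  set A := expR (l * y / 2); set B := expR (k * y / 2) => h3.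
  have e0 := expR_gt0 `|y|.
  have h4 : ((l - k) * y / 2) ^+ 2 * expR `|y| <=
            (l - k) ^+ 2 * (expR (2 * y) + expR (- 2 * y)).
    apply: (@le_trans _ _ ((l - k) ^+ 2 * (expR `|y| * expR `|y|))); last first.
      by rewrite ler_wpM2l// sqr_ge0.
    have -> : ((l - k) * y / 2) ^+ 2 * expR `|y| =
              (l - k) ^+ 2 * (y ^+ 2 / 4 * expR `|y|) by field.
    by rewrite ler_wpM2l ?sqr_ge0// ler_wpM2r ?expR_ge0//; lra.
  nra.
(* The affinity is [m] over the geometric mean of [M l] and [M k], hence at least [m / T] with [T]
   their arithmetic mean. Here [m >= T - K * (l - k)^2 / 2] and [T >= D^-1]. *)
exists (K * D / 2); first by rewrite divr_gt0// mulr_gt0.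
move=> l k l1 k1.
have := M2 _ _ l1 k1.
rewrite expRB -/(M _).
set m := M ((l + k) / 2).
have s : expR ((psi l + psi k) / 2) <= (M l + M k) / 2.
  have -> : M l = expR (psi l / 2) ^+ 2 by rewrite expr2 -expRD -splitr.
  have -> : M k = expR (psi k / 2) ^+ 2 by rewrite expr2 -expRD -splitr.
  rewrite mulrDl expRD.
  by have := sqr_ge0 (expR (psi l / 2) - expR (psi k / 2)); nra.
have cl : D^-1 <= M l.
  rewrite -(ler_pM2r D0) mulVf ?gt_eqF//.
  by apply: le_trans (Mge l) _; rewrite ler_pM2l// Mle// normrN.
have ck : D^-1 <= M k.
  rewrite -(ler_pM2r D0) mulVf ?gt_eqF//.
  by apply: le_trans (Mge k) _; rewrite ler_pM2l// Mle// normrN.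
move=> h.
have s0 := expR_gt0 ((psi l + psi k) / 2).
set S := expR _ in s s0 *.
have m0 : 0 < m by exact: M0.
have h2 := sqr_ge0 (l - k).
set H := (l - k) ^+ 2 in h h2 *.
apply: (@le_trans _ _ (m / ((M l + M k) / 2))); last first.
  by rewrite ler_pM2l// lef_pV2// posrE// divr_gt0// addr_gt0.
have T0 : 0 < (M l + M k) / 2 by rewrite divr_gt0// addr_gt0.
rewrite ler_pdivlMr//.
have : D^-1 <= (M l + M k) / 2 by lra.
rewrite -(ler_pM2l D0) divff ?gt_eqF//.
set T := (M l + M k) / 2 in T0 *.
have e : M l + M k = 2 * T by rewrite /T; field.
rewrite e in h.
move=> dt.
have p : 0 <= K * H * (D * T - 1).
  by rewrite mulr_ge0 ?subr_ge0// mulr_ge0// ltW.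
lra.
Qed.

End expo.

(** * Gaussian moments *)

Section normal.
Context (R : realType) d (Omega : measurableType d) (P : probability Omega R).
Variables (Z : Omega -> R) (m s : R).
Hypotheses (mZ : measurable_fun [set: Omega] Z) (hZ : normal_law P Z m s).

Lemma integral_normal_law (nu : {measure set (measurableTypeR R) -> \bar R})
    (g : measurableTypeR R -> \bar R) :
  (forall A, measurable A -> P (Z @^-1` A) = nu A) ->
  measurable_fun [set: measurableTypeR R] g -> (forall x, (0 <= g x)%E) ->
  (\int[P]_w g (Z w) = \int[nu]_x g x)%E.
Proof.
move=> ZE mg g0.
rewrite -(@eq_measure_integral _ _ _ setT nu (pushforward P (Z : Omega -> measurableTypeR R))).
  by rewrite (ge0_integral_pushforward (phi := Z : Omega -> measurableTypeR R)).
by move=> A mA _; exact: ZE.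
Qed.

Lemma normal_law_mgf (u : R) : s != 0 ->
  (\int[P]_w (expR (u * Z w))%:E = (expR (m * u + s ^+ 2 * u ^+ 2 / 2))%:E)%E.
Proof.
move=> s0.
have mE : measurable_fun [set: measurableTypeR R] (fun x : R => (expR (u * x))%:E).
  by apply/measurable_EFinP; apply: measurableT_comp => //; exact: measurable_funM.
have E0 (x : R) : (0 <= (expR (u * x))%:E)%E by rewrite lee_fin expR_ge0.
rewrite (@integral_normal_law (normal_prob m s) (fun x => (expR (u * x))%:E))//; last first.
  by move=> A mA; rewrite hZ// (negbTE s0).
have [nu [nuE nuI]] := exists_density (@lebesgue_measure R) (measurable_normal_pdf m s)
  (normal_pdf_ge0 m s).
rewrite (eq_measure_integral nu); last by move=> A mA _; rewrite nuE.
rewrite nuI//.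
(* Completing the square: the exponential tilt moves the mean from [m] to [m + s^2 * u]. *)
transitivity (\int[lebesgue_measure]_x ((expR (m * u + s ^+ 2 * u ^+ 2 / 2))%:E *
   (normal_pdf (m + s ^+ 2 * u) s x)%:E))%E.
  apply: eq_integral => x _; rewrite -!EFinM !normal_pdfE//; congr (_%:E).
  rewrite [LHS]mulrCA [RHS]mulrCA; congr (_ * _); rewrite /normal_fun -!expRD.
  by congr expR; field.
rewrite ge0_integralZl//.
- by rewrite integral_normal_pdf mule1.
- by apply/measurable_EFinP; exact: measurable_normal_pdf.
- by move=> x _; rewrite lee_fin normal_pdf_ge0.
Qed.

End normal.

Section integral_le.
Context d (T : measurableType d) (R : realType) (mu : {measure set T -> \bar R}).

(** Common form of the estimates below: a pointwise bound by at most three terms, often obtained by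
    Young's inequality where Cauchy-Schwarz would be usual. A slot that is not wanted receives the
    zero function. *)
Lemma ge0_integral_le_lin3 (f g1 g2 g3 : T -> R) (a1 a2 a3 : R) :
  measurable_fun [set: T] f -> measurable_fun [set: T] g1 ->
  measurable_fun [set: T] g2 -> measurable_fun [set: T] g3 ->
  (forall x, 0 <= f x) -> (forall x, 0 <= g1 x) ->
  (forall x, 0 <= g2 x) -> (forall x, 0 <= g3 x) ->
  0 <= a1 -> 0 <= a2 -> 0 <= a3 ->
  (forall x, f x <= a1 * g1 x + a2 * g2 x + a3 * g3 x) ->
  (\int[mu]_x (f x)%:E <= a1%:E * \int[mu]_x (g1 x)%:E +
    a2%:E * \int[mu]_x (g2 x)%:E + a3%:E * \int[mu]_x (g3 x)%:E)%E.
Proof.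
move=> mf mg1 mg2 mg3 f0 g10 g20 g30 a10 a20 a30 fg.
have Z (a : R) (g : T -> R) : measurable_fun [set: T] g -> (forall x, 0 <= g x) -> 0 <= a ->
    (a%:E * \int[mu]_x (g x)%:E = \int[mu]_x (a * g x)%:E)%E.
  move=> mg g0 a0; under [RHS]eq_integral do rewrite EFinM.
  rewrite ge0_integralZl//; first exact/measurable_EFinP.
  by move=> x _; rewrite lee_fin.
have mZ (a : R) (g : T -> R) : measurable_fun [set: T] g -> measurable_fun [set: T] (fun x => a * g x).
  by move=> mg; exact: measurable_funM.
rewrite !Z// -!ge0_integralD//; try (by move=> x _; rewrite ?lee_fin ?adde_ge0 ?lee_fin ?mulr_ge0);
  try (by apply/measurable_EFinP; exact: mZ).
- apply: ge0_le_integral => //; try (by move=> x _; rewrite ?adde_ge0 ?lee_fin ?mulr_ge0);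
    try exact/measurable_EFinP.
  by apply: emeasurable_funD; [apply: emeasurable_funD|]; apply/measurable_EFinP; exact: mZ.
- by move=> x _; rewrite adde_ge0 ?lee_fin ?mulr_ge0.
- by apply: emeasurable_funD; apply/measurable_EFinP; exact: mZ.
Qed.

End integral_le.

Section moments.
Context (R : realType) d (Omega : measurableType d) (P : probability Omega R).
Implicit Types (Z : Omega -> R) (m s : R).

(** A variable of bounded kurtosis cannot concentrate its second moment [r] on an event of small
    probability. Off [A], Young's inequality gives [Z^2 <= (k / r) * Z^4 + r / (4 * k)]; for
    [k = (4 * C)^-1] each of the two terms contributes at most [r / 4]. *)
Lemma second_moment_truncation Z (C : R) (A : set Omega) :
  measurable_fun [set: Omega] Z -> 0 < C -> measurable A ->
  (\int[P]_w (Z w ^+ 2)%:E < +oo)%E ->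
  (\int[P]_w (Z w ^+ 4)%:E <= C%:E * (\int[P]_w (Z w ^+ 2)%:E) ^+ 2)%E ->
  (P (~` A) <= ((4 * C)^-1)%:E)%E ->
  (\int[P]_w (Z w ^+ 2)%:E <= 2%:E * \int[P]_(w in A) (Z w ^+ 2)%:E)%E.
Proof.
move=> mZ C0 mA.
have mX n : measurable_fun [set: Omega] (fun w => Z w ^+ n) by exact: measurable_funX.
have mXA : measurable_fun [set: Omega] (fun w => Z w ^+ 2 * \1_A w) by exact: measurable_funM.
set q := (\int[P]_w (Z w ^+ 2)%:E)%E.
have q0 : (0 <= q)%E by apply: integral_ge0 => w _; rewrite lee_fin sqr_ge0.
have AE : (\int[P]_(w in A) (Z w ^+ 2)%:E = \int[P]_w (Z w ^+ 2 * \1_A w)%:E)%E.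
  rewrite integral_mkcond; apply: eq_integral => w _; rewrite patchE indicE.
  by case: ifP; rewrite ?mulr1 ?mulr0.
rewrite AE.
have tA : (0 <= \int[P]_w (Z w ^+ 2 * \1_A w)%:E)%E.
  by apply: integral_ge0 => w _; rewrite lee_fin mulr_ge0// sqr_ge0.
move=> qoo h4 hA.
have qE : q = (fine q)%:E by rewrite fineK// ge0_fin_numE.
move: (fine q) qE => r qE; rewrite qE lee_fin in q0 h4 *.
rewrite -EFin_expe -EFinM in h4.
have [->|rn0] := eqVneq r 0; first by rewrite mule_ge0.
have {rn0}r0 : 0 < r by rewrite lt_def rn0.
pose k := (4 * C)^-1.
have k0 : 0 < k by rewrite invr_gt0 mulr_gt0.
have pt w : Z w ^+ 2 <= 1 * (Z w ^+ 2 * \1_A w) + k / r * Z w ^+ 4 + r / (4 * k) * \1_(~` A) w.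
  have zr : 0 <= k / r * Z w ^+ 4 by rewrite mulr_ge0 ?exprn_even_ge0// divr_ge0// ltW.
  rewrite !indicE in_setC; case: (w \in A) => /=.
    by rewrite mulr1 mulr0 mul1r addr0 lerDl.
  rewrite !mulr0 add0r mulr1.
  have -> : k / r * Z w ^+ 4 + r / (4 * k) = Z w ^+ 2 + k / r * (Z w ^+ 2 - r / (2 * k)) ^+ 2.
    by field; rewrite !gt_eqF.
  by rewrite lerDl mulr_ge0 ?sqr_ge0// divr_ge0// ltW.
have mAC : measurable (~` A) by exact: measurableC.
have := @ge0_integral_le_lin3 _ _ _ P (fun w => Z w ^+ 2) _ (fun w => Z w ^+ 4) (\1_(~` A))
  _ _ _ (mX 2%N) mXA (mX 4%N) _ _ _ _ _ _ _ _ pt.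
rewrite -/q qE integral_indic// setIT mul1e => H.
have {}H : (r%:E <= \int[P]_w (Z w ^+ 2 * \1_A w)%:E + (k / r * (C * r ^+ 2))%:E + (r / (4 * k) * k)%:E)%E.
  apply: (le_trans (H _ _ _ _ _ _ _ _)).
  - exact: measurable_indic.
  - by move=> w; exact: sqr_ge0.
  - by move=> w; rewrite mulr_ge0// sqr_ge0.
  - by move=> w; rewrite exprn_even_ge0.
  - by move=> w; rewrite indicE.
  - by [].
  - by rewrite divr_ge0 ?ltW.
  - by rewrite divr_ge0 ?mulr_ge0 ?ltW.
  - rewrite !EFinM -!EFinM; apply: leeD; first apply: leeD => //.
      by rewrite [leRHS]EFinM lee_pmul2l// lte_fin divr_gt0.
    by rewrite [leRHS]EFinM lee_pmul2l// lte_fin divr_gt0// mulr_gt0.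
have e1 : k / r * (C * r ^+ 2) = r / 4 by rewrite /k; field; rewrite !gt_eqF.
have e2 : r / (4 * k) * k = r / 4 by field; rewrite gt_eqF.
move: H; rewrite e1 e2; clear h4.
case: (\int[P]_w _)%E tA => [t||]//= t0; last by rewrite mulry gtr0_sg// mul1e leey.
by rewrite -!EFinD -EFinM !lee_fin; lra.
Qed.

(** Only the moment generating function is used. With [q = m^2 + s^2] and [v = Z / sqrt q], the
    bound [v^4 <= 16 * expR (2 * |v|)] controls the fourth moment by [q^2]. Conversely, comparing
    the mean of [expR (k * v) + expR (- k * v)] with its expansion at small [k] bounds [q] by the
    second moment. *)
Lemma normal_law_moments : exists2 C : R, 0 < C & forall Z m s,
  measurable_fun [set: Omega] Z -> normal_law P Z m s ->
  (\int[P]_w (Z w ^+ 2)%:E < +oo)%E /\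
  (\int[P]_w (Z w ^+ 4)%:E <= C%:E * (\int[P]_w (Z w ^+ 2)%:E) ^+ 2)%E.
Proof.
(* The fourth moment is at most [32 * expR 4 * q^2], and [q] is at most [8 * expR 1] times the
   second moment. *)
exists (32 * expR 4 * (64 * expR 1 ^+ 2)).
  by rewrite !mulr_gt0 ?expR_gt0// exprn_gt0 ?expR_gt0.
move=> Z m s mZ hZ.
have mX n : measurable_fun [set: Omega] (fun w => Z w ^+ n) by exact: measurable_funX.
have [s0|s0] := eqVneq s 0.
  have mn n : (\int[P]_w `|Z w ^+ n|%:E = `|m ^+ n|%:E)%E.
    rewrite (@integral_normal_law _ _ _ _ _ mZ (@dirac _ (measurableTypeR R) m R) (fun x => `|x ^+ n|%:E)).
    - rewrite integral_dirac//; last by apply/measurable_EFinP; apply: measurableT_comp => //; exact: measurable_funX.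
      by rewrite diracT mul1e.
    - by move=> A mA; rewrite hZ// s0 eqxx.
    - by apply/measurable_EFinP; apply: measurableT_comp => //; exact: measurable_funX.
    - by move=> x; rewrite lee_fin.
  have e n : ~~ odd n -> (\int[P]_w (Z w ^+ n)%:E = (m ^+ n)%:E)%E.
    move=> on; have := mn n; rewrite ger0_norm ?exprn_even_ge0// => <-.
    by apply: eq_integral => w _; rewrite ger0_norm// exprn_even_ge0.
  rewrite !e// ltry; split=> //.
  rewrite -EFin_expe -EFinM lee_fin -exprM ler_peMl ?exprn_even_ge0//.
  have h4 : 1 <= expR 4 :> R by rewrite -expR0 ler_expR.
  have h1 : 1 <= expR 1 :> R by rewrite -expR0 ler_expR.
  by nra.
pose q := m ^+ 2 + s ^+ 2.
have q0 : 0 < q by rewrite ltr_wpDl ?sqr_ge0// exprn_even_gt0.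
pose g := Num.sqrt q.
have g0 : 0 < g by rewrite sqrtr_gt0.
have gq : g ^+ 2 = q by rewrite sqr_sqrtr// ltW.
have mE u : measurable_fun [set: Omega] (fun w => expR (u * Z w)).
  by apply: measurableT_comp => //; exact: measurable_funM.
have mgf := @normal_law_mgf _ _ _ P Z m s mZ hZ _ s0.
have mg : `|m| <= g.
  by rewrite -sqrtr_sqr ler_sqrt// ?lerDl ?sqr_ge0// ltW.
have hM a : (\int[P]_w (expR (a / g * Z w))%:E <= (expR (`|a| + a ^+ 2 / 2))%:E)%E.
  rewrite mgf lee_fin ler_expR lerD//.
    rewrite (le_trans (ler_norm _))// !normrM normfV (gtr0_norm g0) mulrCA ler_piMr//.
    by rewrite ler_pdivrMr// mul1r.
  rewrite ler_pM2r// expr_div_n gq mulrCA ler_piMr ?sqr_ge0//.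
  by rewrite ler_pdivrMr// mul1r lerDr sqr_ge0.
pose v w := Z w / g.
have vE a w : a / g * Z w = a * v w by rewrite /v; field; rewrite gt_eqF.
have ZE w : Z w = g * v w by rewrite /v mulrC divfK// gt_eqF.
have v4 w : v w ^+ 4 <= 16 * (expR `|v w| * expR `|v w|).
  have := sqr_le_expR (v w); rewrite -[4%N]/(2 * 2)%N exprM.
  have := sqr_ge0 (v w); have := expR_ge0 `|v w|; nra.
have m1 : measurable_fun [set: Omega] (fun=> 1 : R) by [].
have m0 : measurable_fun [set: Omega] (fun=> 0 : R) by [].
have I1 : (\int[P]_w (1 : R)%:E = 1)%E.
  by rewrite integral_cst// mul1e; exact: probability_setT.
have Z40 w : 0 <= Z w ^+ 4 by rewrite exprn_even_ge0.
have E4 : (\int[P]_w (Z w ^+ 4)%:E <= (32 * expR 4 * q ^+ 2)%:E)%E.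
  have q2 : 0 <= 16 * q ^+ 2 by rewrite mulr_ge0// sqr_ge0.
  apply: le_trans (@ge0_integral_le_lin3 _ _ _ P (fun w => Z w ^+ 4)
    (fun w => expR (2 / g * Z w)) (fun w => expR (- 2 / g * Z w)) (fun=> 0)
    (16 * q ^+ 2) (16 * q ^+ 2) 0 _ _ _ _ _ _ _ _ _ _ _ _) _ => //.
  - move=> w; rewrite mul0r addr0 -mulrDr !vE {1}ZE exprMn.
    have -> : g ^+ 4 = q ^+ 2 by rewrite -gq -exprM.
    rewrite [16 * _]mulrC -[leRHS]mulrA ler_wpM2l ?sqr_ge0//.
    apply: le_trans (v4 w) _; rewrite ler_pM2l//.
    have := expR_norm_le (2 * v w); rewrite normrM (@ger0_norm _ 2)// -mulNr.
    by rewrite -expRD [in 2 * _]mulrDl mul1r.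
  - rewrite mul0e adde0.
    apply: (@le_trans _ _ ((16 * q ^+ 2)%:E * (expR 4)%:E + (16 * q ^+ 2)%:E * (expR 4)%:E)%E).
      have h4 : `|2| + 2 ^+ 2 / 2 = 4 :> R by rewrite ger0_norm//; field.
      have := hM 2; rewrite h4 => h2.
      have := hM (- 2); rewrite normrN sqrrN h4 => h2'.
      by apply: leeD; apply: lee_wpmul2l.
    by rewrite -!EFinM -EFinD lee_fin; lra.
have E2 : (\int[P]_w (Z w ^+ 2)%:E < +oo)%E.
  apply: le_lt_trans (@ge0_integral_le_lin3 _ _ _ P (fun w => Z w ^+ 2)
    (fun=> 1) (fun w => Z w ^+ 4) (fun=> 0) 1 1 0 _ _ _ _ _ _ _ _ _ _ _ _) _ => //.
  - by move=> w; exact: sqr_ge0.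
  - move=> w; rewrite !mul1r mul0r addr0 -[4%N]/(2 * 2)%N exprM.
    by have := sqr_ge0 (Z w ^+ 2 - 1); nra.
  - rewrite I1 mul1e mul0e adde0 mul1e lte_add_pinfty ?ltry//.
    by apply: le_lt_trans E4 _; rewrite ltry.
split=> //.
(* Chosen so that the remainder [32 * k^4 * expR 8] equals [k^2 / 8], half of the gain [k^2 / 4]
   found in [L]. *)
pose k : R := expR (- 4) / 16.
have k0 : 0 < k by rewrite divr_gt0 ?expR_gt0.
have k1 : k <= 1.
  have : expR (- 4) <= 1 :> R by rewrite -expR0 ler_expR oppr_le0.
  by rewrite ler_pdivrMr// mul1r; lra.
have k8 : k ^+ 2 * expR 8 = 1 / 256.
  rewrite /k expr_div_n -expRM_natl mulrAC -expRD.
  have -> : 2%:R * - 4 + 8 = 0 :> R by ring.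
  by rewrite expR0; field.
move: k k0 k1 k8 => k k0 k1 k8.
have cosh a : (\int[P]_w (expR (a / g * Z w) + expR (- a / g * Z w))%:E =
    \int[P]_w (expR (a / g * Z w))%:E + \int[P]_w (expR (- a / g * Z w))%:E)%E.
  under eq_integral do rewrite EFinD.
  by rewrite ge0_integralD//; exact/measurable_EFinP.
have := @ge0_integral_le_lin3 _ _ _ P (fun w => expR (k / g * Z w) + expR (- k / g * Z w))
    (fun w => Z w ^+ 2) (fun=> 1) (fun w => expR (3 / g * Z w) + expR (- 3 / g * Z w))
    (k ^+ 2 * expR 1 / q) 2 (16 * k ^+ 4) _ (mX 2%N) m1 _ _ _ _ _ _ _ _ _.
set A2 := (\int[P]_w (Z w ^+ 2)%:E)%E.
rewrite !cosh I1 mule1 !(mgf (k / g)) !(mgf (- k / g)) => H.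
have A20 : (0 <= A2)%E by apply: integral_ge0 => w _; rewrite lee_fin sqr_ge0.
have A2E : A2 = (fine A2)%:E by rewrite fineK// ge0_fin_numE.
suff qle : q <= 8 * expR 1 * fine A2.
  apply: le_trans E4 _; rewrite A2E -EFin_expe -EFinM lee_fin.
  rewrite -[leRHS]mulrA ler_wpM2l ?mulr_ge0 ?expR_ge0//.
  have -> : 64 * expR 1 ^+ 2 * fine A2 ^+ 2 = (8 * expR 1 * fine A2) ^+ 2 by ring.
  have q0' := ltW q0.
  by apply: lerXn2r; rewrite // nnegrE// (le_trans q0').
have {}H : (expR (m * (k / g) + s ^+ 2 * (k / g) ^+ 2 / 2) +
   expR (m * (- k / g) + s ^+ 2 * (- k / g) ^+ 2 / 2) <=
   k ^+ 2 * expR 1 / q * fine A2 + 2 + 16 * k ^+ 4 * (2 * expR 8)).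
  rewrite -lee_fin EFinD; apply: (le_trans (H _ _ _ _ _ _ _ _ _ _)).
  - exact: measurable_funD.
  - exact: measurable_funD.
  - by move=> w; rewrite addr_ge0 ?expR_ge0.
  - by move=> w; exact: sqr_ge0.
  - by [].
  - by move=> w; rewrite addr_ge0 ?expR_ge0.
  - by rewrite mulr_ge0 ?mulr_ge0 ?expR_ge0 ?sqr_ge0 ?invr_ge0// ltW.
  - by [].
  - by rewrite mulr_ge0// exprn_ge0// ltW.
  - move=> w; rewrite mulr1 !vE.
    set x := v w.
    have a2 : `|k * x / 2| <= k * `|x| / 2 by rewrite !normrM (gtr0_norm k0) [`|2^-1|]ger0_norm.
    have b2 : `|- k * x / 2| <= k * `|x| / 2 by rewrite !normrM normrN (gtr0_norm k0) [`|2^-1|]ger0_norm.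
    have := expR_lipschitz a2 b2.
    have -> : 2 * (k * `|x| / 2) = k * `|x| by field.
    have -> : k * x / 2 - - k * x / 2 = k * x by field.
    have e1 : expR (k * x) = expR (k * x / 2) ^+ 2 by rewrite expr2 -expRD -splitr.
    have e2 : expR (- k * x) = expR (- k * x / 2) ^+ 2 by rewrite expr2 -expRD -splitr.
    have e3 : expR (k * x / 2) * expR (- k * x / 2) = 1.
      by rewrite -expRD -[RHS]expR0; congr expR; field.
    have -> : (expR (k * x / 2) - expR (- k * x / 2)) ^+ 2 = expR (k * x) + expR (- k * x) - 2.
      by rewrite e1 e2; move: e3; set a := expR _; set b := expR _ => e3; rewrite sqrrB e3; ring.
    move=> h1.
    (* If [k * |x| > 1], then [(k * x)^2 >= 1] and [k <= 1] make the second term alone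
       sufficient. *)
    have h2 : expR (k * `|x|) <= expR 1 + (k * x) ^+ 2 * expR `|x|.
      have [le1|gt1] := leP (k * `|x|) 1.
        by rewrite (le_trans (_ : _ <= expR 1)) ?ler_expR// lerDl mulr_ge0 ?sqr_ge0 ?expR_ge0.
      rewrite (@le_trans _ _ ((k * x) ^+ 2 * expR `|x|))// ?lerDr ?expR_ge0//.
      have hx : 1 <= (k * x) ^+ 2.
        rewrite -(real_normK (num_real (k * x))) normrM (gtr0_norm k0).
        by rewrite exprn_ege1// ltW.
      rewrite (@le_trans _ _ (expR `|x|))//; last by rewrite ler_peMl ?expR_ge0.
      by rewrite ler_expR ler_piMl.
    have h3 := v4 w; rewrite -/x in h3.
    have h4 : expR `|x| * expR `|x| * expR `|x| <= expR (3 * x) + expR (- 3 * x).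
      have := expR_norm_le (3 * x); rewrite normrM (@ger0_norm _ 3)// -mulNr.
      rewrite -!expRD; have -> // : 3 * `|x| = `|x| + `|x| + `|x| by ring.
    have h5 : (k * x) ^+ 2 * ((k * x) ^+ 2 * expR `|x|) <= 16 * k ^+ 4 * (expR (3 * x) + expR (- 3 * x)).
      have -> : (k * x) ^+ 2 * ((k * x) ^+ 2 * expR `|x|) = k ^+ 4 * (x ^+ 4 * expR `|x|) by ring.
      rewrite [16 * _]mulrC -[leRHS]mulrA ler_wpM2l ?exprn_even_ge0//.
      apply: (@le_trans _ _ (16 * (expR `|x| * expR `|x| * expR `|x|))); last by rewrite ler_pM2l.
      by rewrite [leRHS]mulrA ler_wpM2r ?expR_ge0.
    have h6 : (k * x) ^+ 2 * expR (k * `|x|) <= (k * x) ^+ 2 * (expR 1 + (k * x) ^+ 2 * expR `|x|).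
      by rewrite ler_wpM2l// sqr_ge0.
    have -> : k ^+ 2 * expR 1 / q * Z w ^+ 2 = (k * x) ^+ 2 * expR 1.
      by rewrite ZE -gq -/x; field; rewrite gt_eqF.
    rewrite mulrDr in h6; clear H; lra.
  - clear H; rewrite !EFinD; apply: leeD; last first.
      rewrite [leRHS]EFinM lee_pmul2l ?lte_fin ?mulr_gt0 ?exprn_gt0//.
      apply: (@le_trans _ _ ((expR 8)%:E + (expR 8)%:E)%E); last first.
        by rewrite -EFinD lee_fin; lra.
      have h8 : `|3| + 3 ^+ 2 / 2 <= 8 :> R by rewrite ger0_norm//; lra.
      apply: leeD.
        by apply: le_trans (hM 3) _; rewrite lee_fin ler_expR.
      by apply: le_trans (hM (- 3)) _; rewrite lee_fin ler_expR normrN sqrrN.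
    by apply: leeD => //; rewrite A2E -EFinM.
pose t := s ^+ 2 * (k / g) ^+ 2 / 2.
pose x := m * (k / g).
have t0 : 0 <= t by rewrite /t mulr_ge0// mulr_ge0 ?sqr_ge0.
(* The right-hand side minus 2 is the square of [expR (x / 2) - expR (- (x / 2))], which is at least
   [(x / 2)^2]. *)
have ch : 2 + x ^+ 2 / 4 <= expR x + expR (- x).
  have e1 : expR x = expR (x / 2) ^+ 2 by rewrite expr2 -expRD -splitr.
  have e2 : expR (- x) = expR (- (x / 2)) ^+ 2.
    by rewrite expr2 -expRD; congr expR; field.
  have e3 : expR (x / 2) * expR (- (x / 2)) = 1 by rewrite -expRD subrr expR0.
  rewrite e1 e2.
  have aux (y : R) : 0 <= y -> y ^+ 2 <= (expR y - expR (- y)) ^+ 2.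
    move=> y0; have := expR_ge1Dx y.
    have : expR (- y) <= 1 by rewrite -expR0 ler_expR oppr_le0.
    by move=> ? ?; nra.
  have h : (x / 2) ^+ 2 <= (expR (x / 2) - expR (- (x / 2))) ^+ 2.
    have [x0|/ltW x0] := leP 0 (x / 2); first exact: aux.
    have := aux (- (x / 2)); rewrite oppr_ge0 opprK sqrrN => /(_ x0) h.
    by rewrite (le_trans h)// -sqrrN opprB.
  move: h e3; set a := expR _; set b := expR _ => h e3.
  by rewrite sqrrB e3 in h; lra.
have et : 1 + t <= expR t by exact: expR_ge1Dx.
have L : 2 + k ^+ 2 / 4 <= expR (m * (k / g) + s ^+ 2 * (k / g) ^+ 2 / 2) +
   expR (m * (- k / g) + s ^+ 2 * (- k / g) ^+ 2 / 2).
  have -> : m * (- k / g) = - x by rewrite /x; field; rewrite gt_eqF.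
  have -> : s ^+ 2 * (- k / g) ^+ 2 / 2 = t by rewrite /t; field; rewrite gt_eqF.
  rewrite -/x -/t !expRD -mulrDl.
  have : (2 + x ^+ 2 / 4) * (1 + t) <= (expR x + expR (- x)) * expR t.
    by apply: ler_pM => //; rewrite addr_ge0// divr_ge0// sqr_ge0.
  have : k ^+ 2 = x ^+ 2 + 2 * t.
    rewrite /x /t -[in LHS](mulr1 (k ^+ 2)) -(divff (lt0r_neq0 q0)) -gq.
    rewrite gq {1}/q -gq; field; by rewrite gt_eqF.
  have : 0 <= x ^+ 2 * t by rewrite mulr_ge0// sqr_ge0.
  have := sqr_ge0 x.
  lra.
have {L}H := le_trans L H.
have k4 : 16 * k ^+ 4 * (2 * expR 8) = k ^+ 2 / 8.
  have -> : 16 * k ^+ 4 * (2 * expR 8) = 32 * k ^+ 2 * (k ^+ 2 * expR 8) by ring.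
  by rewrite k8; field.
rewrite k4 in H.
have k20 : 0 < k ^+ 2 by rewrite exprn_gt0.
have {}H : k ^+ 2 / 8 <= k ^+ 2 * (expR 1 / q * fine A2) by rewrite !mulrA; lra.
rewrite ler_pM2l// in H.
rewrite mulrAC ler_pdivlMr// in H; lra.
Qed.

End moments.

(** * Tails of Gaussian processes *)

Section leb01.
Variable R : realType.

Lemma ae_leb01 (D : set R) : (forall t, t \in `[0, 1] -> D t) -> {ae @leb01 R, forall t, D t}.
Proof.
move=> HD; exists (~` `[0, 1]%classic); split.
- by apply: measurableC; exact: measurable_itv.
- by rewrite /leb01 /mrestr/= setICl measure0.
- by move=> t /= nD h; apply: nD; exact: HD.
Qed.

Lemma L2_integrable_sqr (f : L2 R) : (@leb01 R).-integrable [set: measurableTypeR R] (EFin \o (fun t => f t ^+ 2)).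
Proof. exact: (Lfun2_integrable_sqr (LfunP f)). Qed.

Lemma L2_integrable_mul (f g : L2 R) :
  (@leb01 R).-integrable [set: measurableTypeR R] (EFin \o (fun t => f t * g t)).
Proof. exact/Lfun1_integrable/(Lfun2_mul_Lfun1 (LfunP f) (LfunP g)). Qed.

Lemma measurable_L2 (f : L2 R) : measurable_fun [set: measurableTypeR R] (f : measurableTypeR R -> R).
Proof. by have := LfunP f; rewrite inE => /andP[/[!inE]]. Qed.

Lemma ip01E (f g : L2 R) : (\int[@leb01 R]_t (f t * g t)%:E = (ip01 f g)%:E)%E.
Proof. by rewrite /ip01 /Rintegral fineK//; apply: integrable_fin_num => //; exact: L2_integrable_mul. Qed.

End leb01.

Section process.
Context (R : realType) d (Omega : measurableType d) (P : probability Omega R).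
Variable X : Omega -> L2 R.
Hypothesis mX : measurable_fun [set: Omega * measurableTypeR R]
  (fun p : Omega * measurableTypeR R => X p.1 p.2 : measurableTypeR R).
Local Notation L := (@leb01 R).

Lemma measurable_process_prod (h : Omega * measurableTypeR R -> R) :
  measurable_fun [set: Omega * measurableTypeR R] h ->
  measurable_fun [set: Omega * measurableTypeR R] (fun p => X p.1 p.2 * h p).
Proof. by move=> mh; exact: measurable_funM. Qed.

Lemma measurable_process_at t : measurable_fun [set: Omega] (fun w => X w t).
Proof.
have : measurable_fun [set: Omega] ((fun p : Omega * measurableTypeR R => X p.1 p.2) \o (fun w => (w, t))).
  by apply: measurableT_comp => //.
by [].
Qed.

Lemma measurable_process_ip (h : L2 R) : measurable_fun [set: Omega] (fun w => ip01 (X w) h).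
Proof.
have mXh : measurable_fun [set: Omega * measurableTypeR R] (fun p : Omega * measurableTypeR R => (X p.1 p.2 * h p.2)%:E).
  apply/measurable_EFinP; apply: measurable_process_prod.
  by apply: (measurableT_comp (measurable_L2 h)).
apply: measurableT_comp; first exact: fine_measurable.
under eq_fun do rewrite integralE.
apply: emeasurable_funB.
  by have := @measurable_fun_fubini_tonelli_F _ _ _ _ _ L _ (measurable_funepos mXh) (funepos_ge0 _); rewrite /fubini_F !funepos.unlock.
by have := @measurable_fun_fubini_tonelli_F _ _ _ _ _ L _ (measurable_funeneg mXh) (funeneg_ge0 _); rewrite /fubini_F !funeneg.unlock.
Qed.

Let N w := (\int[L]_t (X w t ^+ 2)%:E)%E.

Let mX2 n : measurable_fun [set: Omega * measurableTypeR R]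
  (fun p : Omega * measurableTypeR R => (X p.1 p.2 ^+ n)%:E).
Proof. by apply/measurable_EFinP; exact: measurable_funX. Qed.

Let mN : measurable_fun [set: Omega] N.
Proof.
apply: (@measurable_fun_fubini_tonelli_F _ _ _ _ _ L _ (mX2 2)).
by move=> p; rewrite lee_fin sqr_ge0.
Qed.

Let N0 w : (0 <= N w)%E.
Proof. by apply: integral_ge0 => t _; rewrite lee_fin sqr_ge0. Qed.

Let N_fin w : (N w < +oo)%E.
Proof.
have /integrableP[_] := L2_integrable_sqr (X w).
by under eq_integral do rewrite /= ger0_norm ?sqr_ge0//.
Qed.

(** Every path is in L^2, so [N] is finite everywhere and the events [N > n] decrease to the empty
    set. *)
Let sublevel (e : R) : 0 < e -> exists2 n : nat, measurable [set w | (N w <= n%:R%:E)%E] &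
  (P (~` [set w | (N w <= n%:R%:E)%E]) <= e%:E)%E.
Proof.
move=> e0.
have mle n : measurable [set w | (N w <= n%:R%:E)%E].
  by rewrite -[X in measurable X]setTI; exact: emeasurable_fun_infty_c.
pose F n := ~` [set w | (N w <= n%:R%:E)%E].
have FI : \bigcap_n F n = set0.
  apply/seteqP; split=> // w /= Fw.
  have fN : N w \is a fin_num by rewrite ge0_fin_numE.
  apply: (Fw (Num.truncn (fine (N w))).+1 Logic.I).
  rewrite /= -(fineK fN) lee_fin.
  by rewrite ltW// truncnS_gt.
have : (P \o F) n @[n --> \oo] --> P (\bigcap_n F n).
  apply: nonincreasing_cvg_mu.
  - by apply: (le_lt_trans (probability_le1 P _)); rewrite ?ltry//; exact: measurableC.
  - by move=> i; exact: measurableC.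
  - by rewrite FI.
  - move=> m n mn; apply/subsetPset => w /= h1 h2; apply: h1.
    by apply: (le_trans h2); rewrite lee_fin ler_nat.
rewrite FI measure0 => cvgP.
have nb : nbhs (0%E : \bar R) [set x | (x < e%:E)%E].
  by apply: open_nbhs_nbhs; split; [exact: open_ereal_lt_ereal|rewrite /= lte_fin].
have [n _ /(_ n (leqnn n)) /= h] := cvgP _ nb.
by exists n => //; exact: ltW.
Qed.

Hypothesis gX : gaussian_process01 P (fun w => X w).

Let q t := (\int[P]_w (X w t ^+ 2)%:E)%E.

Let q0 t : (0 <= q t)%E.
Proof. by apply: integral_ge0 => w _; rewrite lee_fin sqr_ge0. Qed.

Let mq : measurable_fun [set: measurableTypeR R] q.
Proof.
apply: (@measurable_fun_fubini_tonelli_G _ _ _ _ _ P _ (mX2 2)).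
by move=> p; rewrite lee_fin sqr_ge0.
Qed.

Lemma gaussian_process_law_at t : t \in `[0, 1] -> exists m s, normal_law P (fun w => X w t) m s.
Proof.
move=> t01; have [m [s ms]] := gX (m := 1%N) (t := fun=> t) (fun=> 1) (fun=> t01).
exists m, s; rewrite (_ : (fun w => X w t) = (fun w => \sum_(i < 1) 1 * X w t))//.
by apply/funext => w; rewrite big_ord1 mul1r.
Qed.

Let moments : exists2 C : R, 0 < C & forall t, t \in `[0, 1] ->
  (q t < +oo)%E /\ (\int[P]_w (X w t ^+ 4)%:E <= C%:E * q t ^+ 2)%E.
Proof.
have [C C0 HC] := normal_law_moments P.
exists C => // t t01; have [m [s ms]] := gaussian_process_law_at t01.
by apply: HC ms; exact: measurable_process_at.
Qed.

(** Finiteness of the trace comes from the paths. On an event [A] where the squared norm is at most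
    [n], Tonelli bounds the truncated trace by [n]. The kurtosis constant is the same for all t in
    [0, 1], so one [A] of probability close to 1 carries at least half of [q t] for all these t at
    once. *)
Lemma gaussian_process_trace : exists2 tau : R, 0 <= tau & (\int[L]_t q t <= tau%:E)%E.
Proof.
have [C C0 HC] := moments.
have k0 : 0 < (4 * C)^-1 by rewrite invr_gt0 mulr_gt0.
have [n mA PA] := sublevel k0.
set A := [set w | _] in mA PA.
exists (2 * n%:R); first by rewrite mulr_ge0.
have mXA : measurable_fun [set: Omega * measurableTypeR R]
    (fun p : Omega * measurableTypeR R => (X p.1 p.2 ^+ 2 * \1_A p.1)%:E).
  apply/measurable_EFinP; apply: measurable_funM; first exact: measurable_funX.
  by apply: measurableT_comp => //; exact: measurable_indic.
have XA0 p : (0 <= (X p.1 p.2 ^+ 2 * \1_A p.1)%:E)%E.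
  by rewrite lee_fin mulr_ge0 ?sqr_ge0.
pose G t := (\int[P]_w (X w t ^+ 2 * \1_A w)%:E)%E.
have mG : measurable_fun [set: measurableTypeR R] G.
  exact: (@measurable_fun_fubini_tonelli_G _ _ _ _ _ P _ mXA XA0).
have G0 t : (0 <= G t)%E.
  by apply: integral_ge0 => w _; rewrite lee_fin mulr_ge0 ?sqr_ge0.
apply: (@le_trans _ _ (\int[L]_t (2%:E * G t))%E).
  apply: ae_ge0_le_integral => //.
  - by move=> t _; rewrite mule_ge0.
  - exact: measurable_funeM.
  - apply: ae_leb01 => t t01 _.
    have [qoo q4] := HC t t01.
    have mXt : measurable_fun [set: Omega] (fun w => X w t) by exact: measurable_process_at.
    apply: le_trans (second_moment_truncation mXt C0 mA qoo q4 PA) _.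
    rewrite lee_pmul2l// integral_mkcond le_eqVlt; apply/orP; left; apply/eqP.
    by apply: eq_integral => w _; rewrite patchE indicE; case: ifP; rewrite ?mulr1 ?mulr0.
rewrite ge0_integralZl// EFinM lee_pmul2l//.
rewrite -(@fubini_tonelli _ _ _ _ _ P L _ mXA XA0).
apply: (@le_trans _ _ (\int[P]_w (n%:R%:E))%E); last first.
  by rewrite integral_cst//= -[leRHS]mule1 lee_wpmul2l// ?lee_fin//; exact: probability_le1.
apply: ge0_le_integral => //.
- by move=> w _; apply: integral_ge0 => t _; exact: XA0.
- exact: (@measurable_fun_fubini_tonelli_F _ _ _ _ _ L _ mXA XA0).
- move=> w _ /=; rewrite indicE.
  have [wA|wA] := boolP (w \in A).
    by under eq_integral do rewrite mulr1; exact: set_mem wA.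
  by under eq_integral do rewrite mulr0; rewrite integral0 lee_fin.
Qed.

(* With [sigma = q + 1] as weight, [X^2 <= c sigma + X^4 / (4 c sigma)] for every
   [c], so that a large norm of [X w] forces the integral of [X^4 / sigma], which
   has finite expectation, to be large. *)
Lemma gaussian_process_tail : exists2 C : R, 0 < C & forall (h : L2 R) (b : R), 0 < b ->
  ip01 h h <= b -> (P [set w | (1 < `|ip01 (X w) h|)%R] <= (C * b ^+ 2)%:E)%E.
Proof.
have [C C0 HC] := moments.
have [tau tau0 Htau] := gaussian_process_trace.
(* The 1 keeps the weight invertible where the process vanishes. *)
pose sg t := fine (q t) + 1.
have sg1 t : 1 <= sg t by rewrite lerDr fine_ge0.
have sg0 t : 0 < sg t by exact: lt_le_trans (sg1 t).
have msg : measurable_fun [set: measurableTypeR R] sg.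
  by apply: measurable_funD => //; apply: measurableT_comp.
have msgV : measurable_fun [set: measurableTypeR R] (fun t => (sg t)^-1).
  under eq_fun do rewrite -powR_inv1 ?ltW//.
  by apply: (measurableT_comp (measurable_powR _)).
pose S := tau + 1.
have S0 : 0 < S by rewrite ltr_wpDl.
have Ssg : (\int[L]_t (sg t)%:E <= S%:E)%E.
  under eq_integral do rewrite EFinD.
  rewrite ge0_integralD//=.
  - rewrite EFinD; apply: leeD.
      apply: le_trans Htau; apply: ge0_le_integral => //.
      + by move=> t _; rewrite lee_fin fine_ge0.
      + by apply/measurable_EFinP; exact: measurableT_comp.
      + move=> t _; have := q0 t; case: (q t) => //= _; exact: leey.
    by rewrite integral_cst//= mul1e; exact: probability_le1.
  - by move=> t _; rewrite lee_fin fine_ge0.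
  - by apply/measurable_EFinP; exact: measurableT_comp.
pose V w := (\int[L]_t (X w t ^+ 4 / sg t)%:E)%E.
have mV4 : measurable_fun [set: Omega * measurableTypeR R]
    (fun p : Omega * measurableTypeR R => (X p.1 p.2 ^+ 4 / sg p.2)%:E).
  apply/measurable_EFinP; apply: measurable_funM; first exact: measurable_funX.
  exact: (measurableT_comp msgV).
have V40 p : (0 <= (X p.1 p.2 ^+ 4 / sg p.2)%:E)%E.
  by rewrite lee_fin divr_ge0 ?exprn_even_ge0// ltW.
have mV : measurable_fun [set: Omega] V.
  exact: (@measurable_fun_fubini_tonelli_F _ _ _ _ _ L _ mV4 V40).
have V0 w : (0 <= V w)%E.
  by apply: integral_ge0 => t _; exact: (V40 (w, t)).
(* For t in [0, 1], the expectation of X(t)^4 / [sg t] is at most [C * q t ^+ 2 / sg t], hence at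
   most [C * q t], which has finite integral. *)
have EV : (\int[P]_w V w <= (C * tau)%:E)%E.
  rewrite (@fubini_tonelli _ _ _ _ _ P L _ mV4 V40)/=.
  apply: (@le_trans _ _ (\int[L]_t (C%:E * q t))%E); last first.
    rewrite ge0_integralZl//; last by rewrite lee_fin ltW.
    by rewrite EFinM lee_pmul2l.
  apply: ae_ge0_le_integral => //.
  - by move=> t _; apply: integral_ge0 => w _; exact: (V40 (w, t)).
  - exact: (@measurable_fun_fubini_tonelli_G _ _ _ _ _ P _ mV4 V40).
  - by move=> t _; rewrite mule_ge0// lee_fin ltW.
  - exact: measurable_funeM.
  - apply: ae_leb01 => t t01 _.
    have [qoo q4] := HC t t01.
    have qE : q t = (fine (q t))%:E by rewrite fineK// ge0_fin_numE.
    under eq_integral do rewrite mulrC EFinM.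
    rewrite ge0_integralZl//; last 3 first.
    + by apply/measurable_EFinP; apply: measurable_funX; exact: measurable_process_at.
    + by move=> w _; rewrite lee_fin exprn_even_ge0.
    + by rewrite lee_fin invr_ge0 ltW.
    apply: (@le_trans _ _ ((sg t)^-1%:E * (C%:E * q t ^+ 2))%E).
      by rewrite lee_pmul2l// lte_fin invr_gt0.
    rewrite qE -EFin_expe -!EFinM lee_fin mulrCA ler_pM2l//.
    rewrite mulrC ler_pdivrMr// expr2 ler_wpM2l ?fine_ge0//.
    by rewrite /sg lerDl.
(* Markov's inequality gives [S * C * tau]; the added 1 makes the constant positive when [tau] is
   0. *)
exists (S * (C * tau + 1)); first by rewrite mulr_gt0// ltr_wpDl// mulr_ge0// ltW.
move=> h b b0 hb.
pose T := [set w | 1 < `|ip01 (X w) h|].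
have mT : measurable T.
  rewrite -[X in measurable X]setTI; apply: measurable_fun_ltr => //.
  by apply: measurableT_comp => //; exact: measurable_process_ip.
have pt w : ((\1_T w)%:E <= (b ^+ 2 * S)%:E * V w)%E.
  rewrite indicE; have [/set_mem wT|_] := boolP (w \in T); last first.
    by rewrite mule_ge0// lee_fin mulr_ge0 ?sqr_ge0// ltW.
  have mXw := measurable_L2 (X w).
  have mh := measurable_L2 h.
  (* Young's inequality bounds |<X, h>| by [b / 2 * N w + 1 / 2], so a value above 1 forces
     [b * N w] above 1. *)
  have I1 : (1%:E <= b%:E * N w)%E.
    have H1 : ((`|ip01 (X w) h|)%:E <= (b / 2)%:E * N w + (2 * b)^-1%:E * (ip01 h h)%:E)%E.
      rewrite -ip01E -[(`|_|%:E)%E]/(`|(ip01 (X w) h)%:E|)%E -ip01E.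
      apply: le_trans (le_abse_integral _ _ _) _ => //.
        by apply/measurable_EFinP; exact: measurable_funM.
      have := @ge0_integral_le_lin3 _ _ _ L (fun t => `|X w t * h t|) (fun t => X w t ^+ 2)
        (fun t => h t * h t) (fun=> 0) (b / 2) (2 * b)^-1 0.
      rewrite mul0e adde0; apply => //.
      - by apply: measurableT_comp => //; exact: measurable_funM.
      - exact: measurable_funX.
      - exact: measurable_funM.
      - by move=> t; exact: sqr_ge0.
      - by move=> t; rewrite -expr2 sqr_ge0.
      - by rewrite divr_ge0// ltW.
      - by rewrite invr_ge0 mulr_ge0// ltW.
      - move=> t; rewrite mul0r addr0.
        have -> : b / 2 * X w t ^+ 2 + (2 * b)^-1 * (h t * h t) =
           (2 * b)^-1 * ((b * X w t) ^+ 2 + h t ^+ 2) by field; rewrite gt_eqF.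
        rewrite [leRHS]mulrC ler_pdivlMr ?mulr_gt0// normrM.
        have := sqr_ge0 (b * `|X w t| - `|h t|).
        rewrite sqrrB !exprMn !real_normK ?num_real// => ?; lra.
    have N_finE : N w = (fine (N w))%:E by rewrite fineK// ge0_fin_numE.
    move: H1; rewrite N_finE -!EFinM -EFinD !lee_fin => H1.
    have h2 : (2 * b)^-1 * ip01 h h <= 1 / 2.
      by rewrite mulrC ler_pdivrMr ?mulr_gt0//; lra.
    by move: wT; rewrite /T/=; lra.
  (* Makes [c * S] half of [b^-1]. Since [N w >= b^-1], the other half must come from [V w], whence
     [b^2 * S * V w >= 1]. *)
  pose c := (2 * b * S)^-1.
  have c0 : 0 < c by rewrite invr_gt0 !mulr_gt0.
  have H2 : (N w <= c%:E * \int[L]_t (sg t)%:E + (4 * c)^-1%:E * V w)%E.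
    have := @ge0_integral_le_lin3 _ _ _ L (fun t => X w t ^+ 2) sg
        (fun t => X w t ^+ 4 / sg t) (fun=> 0) c (4 * c)^-1 0.
    rewrite mul0e adde0; apply => //.
    - exact: measurable_funX.
    - by apply: measurable_funM => //; exact: measurable_funX.
    - by move=> t; exact: sqr_ge0.
    - by move=> t; rewrite ltW.
    - by move=> t; have := V40 (w, t); rewrite lee_fin.
    - by rewrite ltW.
    - by rewrite invr_ge0 mulr_ge0// ltW.
    - move=> t; rewrite mul0r addr0.
      have -> : c * sg t + (4 * c)^-1 * (X w t ^+ 4 / sg t) = X w t ^+ 2 +
         (4 * c * sg t)^-1 * (X w t ^+ 2 - 2 * c * sg t) ^+ 2.
        by field; rewrite !gt_eqF.
      by rewrite lerDl mulr_ge0 ?sqr_ge0// invr_ge0 !mulr_ge0 ?ltW.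
  have H3 : (N w <= (c * S)%:E + (4 * c)^-1%:E * V w)%E.
    by apply: le_trans H2 _; apply: leeD => //; rewrite EFinM lee_pmul2l.
  have N_finE : N w = (fine (N w))%:E by rewrite fineK// ge0_fin_numE.
  rewrite N_finE -EFinM lee_fin in I1.
  have := V0 w; case: (V w) H3 => [v||] //=; last first.
    by move=> _ _; rewrite gt0_muley ?leey// lte_fin mulr_gt0// exprn_gt0.
  rewrite N_finE -!EFinM -EFinD !lee_fin => H3 v0.
  have cS : c * S = (2 * b)^-1 by rewrite /c; field; rewrite !gt_eqF.
  have c4 : (4 * c)^-1 = b * S / 2 by rewrite /c; field; rewrite !gt_eqF.
  rewrite cS c4 in H3.
  have : b * fine (N w) <= b * ((2 * b)^-1 + b * S / 2 * v) by rewrite ler_pM2l.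
  have -> : b * ((2 * b)^-1 + b * S / 2 * v) = 1 / 2 + b ^+ 2 * S * v / 2.
    by field; rewrite gt_eqF.
  by move: I1 => /=; lra.
have -> : (P [set w | (1 < `|ip01 (X w) h|)%R] = \int[P]_w (\1_T w)%:E)%E.
  by rewrite integral_indic// setIT.
apply: (@le_trans _ _ (\int[P]_w ((b ^+ 2 * S)%:E * V w))%E).
  apply: ge0_le_integral => //.
  - exact/measurable_EFinP/measurable_indic.
  - exact: measurable_funeM.
rewrite ge0_integralZl//; last by rewrite lee_fin mulr_ge0 ?sqr_ge0// ltW.
apply: (@le_trans _ _ ((b ^+ 2 * S)%:E * (C * tau)%:E)%E).
  by rewrite lee_pmul2l// lte_fin mulr_gt0// exprn_gt0.
rewrite -EFinM lee_fin.
have : 0 <= b ^+ 2 * S by rewrite mulr_ge0 ?sqr_ge0// ltW.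
set u := C * tau; nra.
Qed.

End process.

(** * Covariance and eigenfunctions *)

Section tensor.
Context d1 d2 (T1 : measurableType d1) (T2 : measurableType d2) (R : realType).
Variables (m1 : {sigma_finite_measure set T1 -> \bar R})
  (m2 : {sigma_finite_measure set T2 -> \bar R}).

Lemma measurable_tensor (u : T1 -> R) (v : T2 -> R) :
  measurable_fun [set: T1] u -> measurable_fun [set: T2] v ->
  measurable_fun [set: T1 * T2] (fun p => u p.1 * v p.2).
Proof.
move=> mu mv; apply: measurable_funM.
  exact: (measurableT_comp mu).
exact: (measurableT_comp mv).
Qed.

Lemma ge0_integral_tensor (u : T1 -> R) (v : T2 -> R) :
  measurable_fun [set: T1] u -> measurable_fun [set: T2] v ->
  (forall x, 0 <= u x) -> (forall y, 0 <= v y) ->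
  (\int[m1]_x \int[m2]_y (u x * v y)%:E =
   (\int[m1]_x (u x)%:E) * (\int[m2]_y (v y)%:E))%E.
Proof.
move=> mu mv u0 v0.
under eq_integral => x _.
  under eq_integral do rewrite EFinM.
  rewrite ge0_integralZl//; last 3 first.
  - exact/measurable_EFinP.
  - by move=> y _; rewrite lee_fin.
  - by rewrite lee_fin.
  over.
rewrite ge0_integralZr//.
- exact/measurable_EFinP.
- by move=> x _; rewrite lee_fin.
- by apply: integral_ge0 => y _; rewrite lee_fin.
Qed.

Lemma integrable_tensor (u : T1 -> R) (v : T2 -> R) :
  m1.-integrable [set: T1] (EFin \o u) -> m2.-integrable [set: T2] (EFin \o v) ->
  (m1 \x m2)%E.-integrable [set: T1 * T2] (fun p => (u p.1 * v p.2)%:E).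
Proof.
move=> iu iv.
have mu : measurable_fun [set: T1] u by apply/measurable_EFinP; exact: measurable_int iu.
have mv : measurable_fun [set: T2] v by apply/measurable_EFinP; exact: measurable_int iv.
apply/integrable12ltyP; first by apply/measurable_EFinP; exact: measurable_tensor.
under eq_integral do under eq_integral do rewrite /= normrM.
rewrite (@ge0_integral_tensor (fun x => `|u x|) (fun x => `|v x|))//; last 2 first.
- exact: measurableT_comp.
- exact: measurableT_comp.
have /integrableP[_ hu] := iu; have /integrableP[_ hv] := iv.
by rewrite lte_mul_pinfty// ?ge0_fin_numE//; apply: integral_ge0 => x _; rewrite lee_fin.
Qed.

Lemma integral_tensor (u : T1 -> R) (v : T2 -> R) :
  m1.-integrable [set: T1] (EFin \o u) -> m2.-integrable [set: T2] (EFin \o v) ->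
  (\int[m1 \x m2]_p (u p.1 * v p.2)%:E =
   (\int[m1]_x (u x)%:E) * (\int[m2]_y (v y)%:E))%E.
Proof.
move=> iu iv; rewrite -integral12_prod_meas1; last exact: integrable_tensor.
rewrite /fubini_F/=.
have fv : (\int[m2]_y (v y)%:E)%E \is a fin_num by exact: integrable_fin_num iv.
under eq_integral => x _.
  under eq_integral do rewrite EFinM.
  rewrite integralZl//.
  over.
by rewrite -(fineK fv) integralZr.
Qed.

Lemma ae_prod (A : set T1) (B : set T2) :
  {ae m1, forall x, A x} -> {ae m2, forall y, B y} ->
  {ae (m1 \x m2)%E, forall p, A p.1 /\ B p.2}.
Proof.
move=> [C [mC C0 AC]] [D [mD D0 BD]].
exists (C `*` setT `|` setT `*` D); split.
- by apply: measurableU; exact: measurableX.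
- apply/eqP; rewrite eq_le measure_ge0 andbT.
  apply: le_trans; first by apply: measureU2; exact: measurableX.
  apply: (@le_trans _ _ (m1 C * m2 setT + m1 setT * m2 D)%E); first by rewrite /= !product_measure1E.
  by rewrite C0 D0 mul0e mule0 adde0.
- move=> p /= /not_andP[nA|nB].
    by left; split => //; apply: AC.
  by right; split => //; apply: BD.
Qed.

End tensor.

(* The library's canonical instances do not present a product of probability
   measures as a sigma-finite measure, unless it is cast to a probability. *)
Definition leb01_sq (R : realType) : probability (measurableTypeR R * measurableTypeR R)%type R :=
  (@leb01 R \x @leb01 R)%E.

Section second_moment.
Context (R : realType) d (Omega : measurableType d) (P : probability Omega R).
Variable X : Omega -> L2 R.
Hypothesis mX : measurable_fun [set: Omega * measurableTypeR R]
  (fun p : Omega * measurableTypeR R => X p.1 p.2 : measurableTypeR R).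
Local Notation L := (@leb01 R).
Hypothesis gX : gaussian_process01 P (fun w => X w).
Variable K : measurableTypeR R * measurableTypeR R -> R.
Hypothesis mK : measurable_fun [set: measurableTypeR R * measurableTypeR R] K.
Hypothesis mean0 : {ae @leb01 R, forall t, 'E_P[fun w => X w t] = 0%E}%E.
Hypothesis covK : {ae (@leb01 R \x @leb01 R)%E, forall p,
  covariance P (fun w => X w p.1) (fun w => X w p.2) = (K p)%:E}.

Local Notation T2 := (measurableTypeR R * measurableTypeR R)%type.

(** Write the squared inner product as a double integral over [0,1]^2 and exchange it with the
    expectation. Young's inequality shows that the absolute double integral is at most ||f||^2
    ||X||^2, integrable by [gaussian_process_trace]. Mean and covariance then enter only under the
    integral, where almost everywhere suffices. *)
Lemma gaussian_process_ip_sqr (f : L2 R) :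
  (\int[P]_w (ip01 (X w) f ^+ 2)%:E = \int[L \x L]_p (f p.1 * f p.2 * K p)%:E)%E.
Proof.
have mf := measurable_L2 f.
have mf1 : measurable_fun [set: measurableTypeR R * measurableTypeR R] (fun p : measurableTypeR R * measurableTypeR R => f p.1) by exact: (measurableT_comp mf).
have mf2 : measurable_fun [set: measurableTypeR R * measurableTypeR R] (fun p : measurableTypeR R * measurableTypeR R => f p.2) by exact: (measurableT_comp mf).
have mXs : measurable_fun [set: Omega * T2] (fun z : Omega * T2 => X z.1 z.2.1).
  have : measurable_fun [set: Omega * T2] ((fun p : Omega * measurableTypeR R => X p.1 p.2) \o (fun z : Omega * T2 => (z.1, z.2.1))).
    apply: measurableT_comp => //; apply: measurable_fun_pair => //=.
    exact: (measurableT_comp measurable_fst).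
  by [].
have mXt : measurable_fun [set: Omega * T2] (fun z : Omega * T2 => X z.1 z.2.2).
  have : measurable_fun [set: Omega * T2] ((fun p : Omega * measurableTypeR R => X p.1 p.2) \o (fun z : Omega * T2 => (z.1, z.2.2))).
    apply: measurableT_comp => //; apply: measurable_fun_pair => //=.
    exact: (measurableT_comp measurable_snd).
  by [].
pose F (z : Omega * T2) := (X z.1 z.2.1 * f z.2.1) * (X z.1 z.2.2 * f z.2.2).
have mF : measurable_fun [set: Omega * T2] (fun z => (F z)%:E).
  apply/measurable_EFinP; apply: measurable_funM; apply: measurable_funM => //.
    exact: (measurableT_comp mf1).
  exact: (measurableT_comp mf2).
have [tau tau0 Htau] := gaussian_process_trace mX gX.
have iF : (P \x leb01_sq R)%E.-integrable [set: Omega * T2] (fun z => (F z)%:E).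
  apply/integrable12ltyP => //.
  pose N w := (\int[L]_t (X w t ^+ 2)%:E)%E.
  have mX2 : measurable_fun [set: Omega * measurableTypeR R]
    (fun p : Omega * measurableTypeR R => (X p.1 p.2 ^+ 2)%:E).
    by apply/measurable_EFinP; exact: measurable_funX.
  have X20 (p : Omega * measurableTypeR R) : (0 <= (X p.1 p.2 ^+ 2)%:E)%E by rewrite lee_fin sqr_ge0.
  have mN : measurable_fun [set: Omega] N.
    exact: (@measurable_fun_fubini_tonelli_F _ _ _ _ _ L _ mX2 X20).
  have N0 w : (0 <= N w)%E by apply: integral_ge0 => t _; rewrite lee_fin sqr_ge0.
  pose a := ip01 f f.
  have a0 : 0 <= a by apply: Rintegral_ge0 => t _; rewrite -expr2 sqr_ge0.
  apply: (@le_lt_trans _ _ (\int[P]_w (a%:E * N w))%E); last first.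
    rewrite ge0_integralZl//.
    rewrite lte_mul_pinfty ?lee_fin//.
    rewrite (@fubini_tonelli _ _ _ _ _ P L _ mX2 X20)/=.
    by apply: le_lt_trans Htau _; rewrite ltry.
  apply: ge0_le_integral => //.
  - by move=> w _; apply: integral_ge0.
  - apply: (@measurable_fun_fubini_tonelli_F _ _ _ _ _ (leb01_sq R) (fun z => `|(F z)%:E|)%E) => //.
    exact: measurableT_comp.
  - exact: measurable_funeM.
  move=> w _ /=.
  have mXw := measurable_L2 (X w).
  have m1 : measurable_fun [set: T2] (fun p : T2 => X w p.1 ^+ 2 * (f p.2 * f p.2)).
    apply: (@measurable_tensor _ _ _ _ _ (fun t => X w t ^+ 2) (fun t => f t * f t)).
      exact: measurable_funX.
    exact: measurable_funM.
  have m2 : measurable_fun [set: T2] (fun p : T2 => (f p.1 * f p.1) * X w p.2 ^+ 2).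
    apply: (@measurable_tensor _ _ _ _ _ (fun t => f t * f t) (fun t => X w t ^+ 2)).
      exact: measurable_funM.
    exact: measurable_funX.
  have iX2 := L2_integrable_sqr (X w).
  have iff := L2_integrable_mul f f.
  have T1E : (\int[leb01_sq R]_p (X w p.1 ^+ 2 * (f p.2 * f p.2))%:E = N w * a%:E)%E.
    by rewrite (integral_tensor iX2 iff) (ip01E f f).
  have T2E : (\int[leb01_sq R]_p ((f p.1 * f p.1) * X w p.2 ^+ 2)%:E = a%:E * N w)%E.
    by rewrite (integral_tensor iff iX2) (ip01E f f).
  have NE : ((1 / 2)%:E * (N w * a%:E) + (1 / 2)%:E * (a%:E * N w) = a%:E * N w)%E.
    have Nf : N w \is a fin_num by exact: integrable_fin_num iX2.
    by rewrite -(fineK Nf) -!EFinM -EFinD; congr (_%:E); field.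
  have := @ge0_integral_le_lin3 _ _ _ (leb01_sq R) (fun p => `|F (w, p)|)
    (fun p => X w p.1 ^+ 2 * (f p.2 * f p.2)) (fun p => (f p.1 * f p.1) * X w p.2 ^+ 2) (fun=> 0)
    (1 / 2) (1 / 2) 0.
  rewrite T1E T2E NE mul0e adde0; apply => //.
  - apply: measurableT_comp => //.
    apply: (@measurable_tensor _ _ _ _ _ (fun t => X w t * f t) (fun t => X w t * f t)); exact: measurable_funM.
  - by move=> p; rewrite mulr_ge0 ?sqr_ge0// -expr2 sqr_ge0.
  - by move=> p; rewrite mulr_ge0 ?sqr_ge0// -expr2 sqr_ge0.
  - move=> [s t]; rewrite /F/= !normrM mul0r addr0.
    have := sqr_ge0 (`|X w s| * `|f t| - `|X w t| * `|f s|).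
    by rewrite sqrrB !exprMn !real_normK ?num_real// !expr2 => ?; lra.
transitivity (\int[P]_w \int[leb01_sq R]_p (F (w, p))%:E)%E.
  apply: eq_integral => w _.
  have iu := L2_integrable_mul (X w) f.
  rewrite (@integral_tensor _ _ _ _ _ L L (fun t => X w t * f t) (fun t => X w t * f t))//.
  by rewrite ip01E -EFinM expr2.
have -> : (\int[P]_w \int[leb01_sq R]_p (F (w, p))%:E = \int[leb01_sq R]_p \int[P]_w (F (w, p))%:E)%E.
  exact: (Fubini iF).
apply: ae_eq_integral => //.
- exact: (measurable_fubini_G iF).
- by apply/measurable_EFinP; apply: measurable_funM => //; exact: measurable_funM.
have := ae_prod mean0 mean0.
apply: filterS2 covK => -[s t] /= cst [es et] _.
have mXs' : measurable_fun [set: Omega] (fun w => X w s) by exact: measurable_process_at.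
have mXt' : measurable_fun [set: Omega] (fun w => X w t) by exact: measurable_process_at.
have XX : (\int[P]_w (X w s * X w t)%:E = (K (s, t))%:E)%E.
  rewrite -cst covariance.unlock es et expectation.unlock.
  apply: eq_integral => w _; congr (_%:E).
  by rewrite -[RHS]/((X w s - 0) * (X w t - 0)) !subr0.
(* The integral equals the real number [K (s, t)], and a finite integral of a measurable real
   function forces integrability. *)
have iXX : P.-integrable [set: Omega] (fun w => (X w s * X w t)%:E).
  apply/integrableP; split; first by apply/measurable_EFinP; exact: measurable_funM.
  rewrite integral_fin_num_abs//; first by rewrite XX.
  exact: measurable_funM.
transitivity (\int[P]_w ((f s * f t)%:E * (X w s * X w t)%:E))%E.
  by apply: eq_integral => w _; rewrite /F/= -EFinM; congr (_%:E); ring.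
by rewrite integralZl// XX -EFinM.
Qed.

End second_moment.

Section eigen.
Variable R : realType.
Local Notation L := (@leb01 R).
Local Notation T2 := (measurableTypeR R * measurableTypeR R)%type.

(** Convergence in L^2 of the square identifies the eigenvalue. Pairing phi_k (x) phi_k with [K]
    minus its [N]-th partial sum gives [c - theta k] as soon as [k < N], and Hoelder with the unit
    norm of the tensor bounds this by a quantity tending to 0. *)
Lemma eigen_quadratic_form (K : measurableTypeR R * measurableTypeR R -> R)
    (theta : nat -> R) (phi : nat -> L2 R) (k : nat) :
  K \in Lfun (L \x L)%E 2%:E -> orthonormal01 phi -> eigen_expansion K theta phi ->
  (\int[L \x L]_p (phi k p.1 * phi k p.2 * K p)%:E = (theta k)%:E)%E.
Proof.
move=> KL on ee.
have mK : measurable_fun [set: T2] K by have := KL; rewrite inE => /andP[/[!inE]].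
pose tens j (p : T2) := phi j p.1 * phi j p.2.
have mtens j : measurable_fun [set: T2] (tens j).
  by apply: measurable_tensor; exact: measurable_L2.
have ip_tensor i j : (\int[leb01_sq R]_p (tens i p * tens j p)%:E = (i == j)%:R%:E)%E /\
    (leb01_sq R).-integrable [set: T2] (fun p => (tens i p * tens j p)%:E).
  have iu := L2_integrable_mul (phi i) (phi j).
  have e : (fun p => (tens i p * tens j p)%:E) =
      (fun p : T2 => ((phi i p.1 * phi j p.1) * (phi i p.2 * phi j p.2))%:E).
    by apply/funext => p; congr (_%:E); rewrite /tens; ring.
  rewrite e; split; last exact: (integrable_tensor iu iu).
  rewrite (integral_tensor iu iu) ip01E on -EFinM.
  by case: (i == j); rewrite ?mulr1 ?mulr0.
have norm_tens j : ('N[leb01_sq R]_2%:E[EFin \o tens j] = 1)%E.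
  rewrite Lnorm.unlock; transitivity ((1%:E : \bar R) `^ 2^-1)%E; last by rewrite poweR_EFin powR1.
  congr (_ `^ _)%E.
  transitivity (\int[leb01_sq R]_p (tens j p * tens j p)%:E)%E; last first.
    by rewrite (ip_tensor j j).1 eqxx.
  apply: eq_integral => p _ /=.
  congr (_%:E); rewrite powR_mulrn//.
  by rewrite real_normK ?num_real// expr2.
have tensL j : tens j \in Lfun (leb01_sq R) 2%:E.
  rewrite inE; apply/andP; split; rewrite inE//=.
  by rewrite /finite_norm norm_tens ltry.
have iK : (leb01_sq R).-integrable [set: T2] (EFin \o (fun p => tens k p * K p)).
  exact/Lfun1_integrable/Lfun2_mul_Lfun1.
have fK := integrable_fin_num measurableT iK.
set c := fine (\int[leb01_sq R]_p (tens k p * K p)%:E)%E.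
have cE : (\int[leb01_sq R]_p (tens k p * K p)%:E = c%:E)%E by rewrite fineK.
suff -> : theta k = c by rewrite -cE.
pose D N (p : T2) := K p - \sum_(j < N) theta j * phi j p.1 * phi j p.2.
have mD N : measurable_fun [set: T2] (D N).
  apply: measurable_funB => //; apply: measurable_sum => j.
  apply: (@measurable_tensor _ _ _ _ _ (fun s => theta j * phi j s) (phi j)); last exact: measurable_L2.
  by apply: measurable_funM => //; exact: measurable_L2.
have sumE N : (k < N)%N ->
    (\int[leb01_sq R]_p (tens k p * D N p)%:E = (c - theta k)%:E)%E.
  move=> kN.
  have iS (j : 'I_N) : (leb01_sq R).-integrable [set: T2] (fun p => ((theta j)%:E * (tens k p * tens j p)%:E)%E).
    by apply: integrableZl => //; exact: (ip_tensor k j).2.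
  transitivity (\int[leb01_sq R]_p ((tens k p * K p)%:E -
      \sum_(j < N) ((theta j)%:E * (tens k p * tens j p)%:E)))%E.
    apply: eq_integral => p _; rewrite /D mulrBr EFinB; congr (_ - _)%E.
    rewrite mulr_sumr -sumEFin; apply: eq_bigr => j _; rewrite -EFinM; congr (_%:E).
    by rewrite /tens; ring.
  rewrite integralB//; last first.
    exact: integrable_sum.
  rewrite cE integral_sum//.
  rewrite (eq_bigr (fun j : 'I_N => (theta j * (k == j)%:R)%:E)); last first.
    by move=> j _; rewrite integralZl ?(ip_tensor k j).1 ?EFinM//; exact: (ip_tensor k j).2.
  rewrite sumEFin -EFinB (bigD1 (Ordinal kN))//= eqxx mulr1 big1 ?addr0//.
  by move=> j /negbTE; rewrite -val_eqE/= eq_sym => ->; rewrite mulr0.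
have bound N : (k < N)%N -> (`|(c - theta k)%:E| <= 'N[leb01_sq R]_2%:E[EFin \o D N])%E.
  move=> kN; rewrite -(sumE N kN).
  apply: (le_trans (le_abse_integral _ _ _)) => //.
    by apply/measurable_EFinP; exact: measurable_funM.
  have := @hoelder _ _ _ (leb01_sq R) (tens k) (D N) 2 2 (mtens k) (mD N) _ _ _.
  rewrite norm_tens mul1e Lnorm1; apply => //.
  by field.
apply/eqP; rewrite eq_sym -subr_eq0; apply/negPn/negP => ne.
have e0 : 0 < `|c - theta k| by rewrite normr_gt0.
have nb : nbhs (0%E : \bar R) [set x | (x < `|c - theta k|%:E)%E].
  by apply: open_nbhs_nbhs; split; [exact: open_ereal_lt_ereal|rewrite /= lte_fin].
have [n _ Hn] := ee _ nb.
have := Hn (maxn n k.+1) (leq_maxl _ _).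
rewrite /= ltNge => /negP; apply.
by apply: bound; rewrite leq_max ltnSn orbT.
Qed.

End eigen.

(** * Laws of the observations *)

Section L2_algebra.
Variable R : realType.
Local Notation L := (@leb01 R).
Implicit Types f g h : L2 R.

Lemma ip01C f g : ip01 f g = ip01 g f.
Proof. by rewrite /ip01; apply: eq_Rintegral => t _; rewrite mulrC. Qed.

Lemma ip01Bl f g h : ip01 (f - g : L2 R) h = ip01 f h - ip01 g h.
Proof.
apply: EFin_inj; rewrite [RHS]EFinB -!ip01E -integralB//; try exact: L2_integrable_mul.
by apply: eq_integral => t _; rewrite -EFinB -mulrBl.
Qed.

Lemma ip01Dl f g h : ip01 (f + g : L2 R) h = ip01 f h + ip01 g h.
Proof.
apply: EFin_inj; rewrite [RHS]EFinD -!ip01E -integralD//; try exact: L2_integrable_mul.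
by apply: eq_integral => t _; rewrite -EFinD -mulrDl.
Qed.

Lemma ip01Zl (a : R) f h : ip01 (a *: f : L2 R) h = a * ip01 f h.
Proof.
apply: EFin_inj; rewrite [RHS]EFinM -!ip01E -integralZl//; try exact: L2_integrable_mul.
by apply: eq_integral => t _; rewrite -EFinM mulrA.
Qed.

Lemma ip010l h : ip01 (0 : L2 R) h = 0.
Proof. by rewrite -[0 in LHS](subrr h) ip01Bl subrr. Qed.

Lemma ip01_suml (I : Type) (r : seq I) (F : I -> L2 R) h :
  ip01 (\sum_(i <- r) F i : L2 R) h = \sum_(i <- r) ip01 (F i) h.
Proof.
elim: r => [|i r IH]; first by rewrite !big_nil ip010l.
by rewrite !big_cons ip01Dl IH.
Qed.

Lemma ip01_ge0 f : 0 <= ip01 f f.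
Proof. by apply: Rintegral_ge0 => t _; rewrite -expr2 sqr_ge0. Qed.

Lemma norm01_sqr f : norm01 f ^+ 2 = ip01 f f.
Proof.
rewrite /norm01 Lnorm.unlock.
have -> : (\int[L]_x (`|(EFin \o f) x| `^ 2) = (ip01 f f)%:E)%E.
  rewrite -ip01E; apply: eq_integral => t _ /=.
  by congr (_%:E); rewrite powR_mulrn// real_normK ?num_real// expr2.
by rewrite poweR_EFin/= -powR_mulrn ?powR_ge0// -powRrM mulVf// powRr1// ip01_ge0.
Qed.

Lemma L2_sumE (I : Type) (r : seq I) (F : I -> L2 R) t :
  (\sum_(i <- r) F i : L2 R) t = \sum_(i <- r) F i t.
Proof.
elim: r => [|i r IH]; first by rewrite !big_nil.
by rewrite !big_cons -IH.
Qed.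

(** Expand the squared norm of [f - v], with [v] the projection of [f] on the family selected by
    [u]. *)
Lemma bessel01 (phi : nat -> L2 R) (m : nat) (u : 'I_m -> nat) f :
  orthonormal01 phi -> injective u ->
  \sum_(i < m) ip01 f (phi (u i)) ^+ 2 <= ip01 f f.
Proof.
move=> on inj_u.
pose c i := ip01 f (phi (u i)).
pose v : L2 R := \sum_(i < m) c i *: phi (u i).
have fv : ip01 f v = \sum_(i < m) c i ^+ 2.
  rewrite ip01C ip01_suml; apply: eq_bigr => i _.
  by rewrite ip01Zl ip01C expr2.
have vv : ip01 v v = \sum_(i < m) c i ^+ 2.
  rewrite ip01_suml; apply: eq_bigr => i _.
  rewrite ip01Zl ip01C ip01_suml (bigD1 i)//= ip01Zl on eqxx mulr1.
  rewrite big1 ?addr0 ?expr2// => j /negbTE ji.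
  by rewrite ip01Zl on (inj_eq inj_u) ji mulr0.
have := ip01_ge0 (f - v); rewrite ip01Bl [ip01 f (f - v)]ip01C [ip01 v (f - v)]ip01C !ip01Bl.
by rewrite [ip01 v f]ip01C fv vv -/c; lra.
Qed.

Lemma measurable_ip01 h : measurable_fun [set: L2 R] (fun x : L2 R => ip01 x h : measurableTypeR R).
Proof.
move=> _ A mA; rewrite setTI; apply: sub_sigma_algebra.
by exists h; exists A.
Qed.

End L2_algebra.

Section gaussian_law.
Variables (R : realType) (Gamma : probability (L2 R) R).
Variables (K : measurableTypeR R * measurableTypeR R -> R).
Variables (theta : nat -> R) (phi : nat -> L2 R).
Hypotheses (hG : gaussian_process_law Gamma 0 K)
  (KL : K \in Lfun (@leb01 R \x @leb01 R)%E 2%:E)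
  (on : orthonormal01 phi) (ee : eigen_expansion K theta phi).

(** Carries the two facts on the process over to the law [Gamma]. They involve X only through events
    in <X, h>, which are measurable by the definition of the sigma-algebra, so the underlying
    probability space is left behind here. *)
Lemma gaussian_law_bounds : exists2 C : R, 0 < C &
  (forall (h : L2 R) (b : R), 0 < b -> ip01 h h <= b ->
    (Gamma [set x | (1 < `|ip01 x h|)%R] <= (C * b ^+ 2)%:E)%E) /\
  (forall k, (\int[Gamma]_x (ip01 x (phi k) ^+ 2)%:E = (theta k)%:E)%E).
Proof.
case: hG => d0 [Om [P [X [mX [gX [mean0 [covK GE]]]]]]].
have transfer (h : L2 R) (A : set (measurableTypeR R)) : measurable A ->
    Gamma [set x | A (ip01 x h)] = P [set w | A (ip01 (X w) h)].
  move=> mA; rewrite GE//.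
  by have := measurable_ip01 h measurableT mA; rewrite setTI.
have mK : measurable_fun [set: measurableTypeR R * measurableTypeR R] K.
  by have := KL; rewrite inE => /andP[/[!inE]].
have [C C0 HC] := gaussian_process_tail mX gX.
exists C => //; split=> [h b b0 hb|k].
  rewrite (transfer h [set x | 1 < `|x|]); first exact: HC.
  by rewrite -[X in measurable X]setTI; exact: measurable_fun_ltr.
rewrite -(eigen_quadratic_form k KL on ee) -(gaussian_process_ip_sqr mX gX mK mean0 covK).
have msq : measurable_fun [set: measurableTypeR R] (fun x : R => (x ^+ 2)%:E).
  by apply/measurable_EFinP; exact: measurable_funX.
have m1 := measurable_ip01 (phi k).
have m2 : measurable_fun [set: Om] (fun w => ip01 (X w) (phi k) : measurableTypeR R).
  exact: measurable_process_ip.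
transitivity (\int[pushforward Gamma (fun x : L2 R => ip01 x (phi k) : measurableTypeR R)]_y (y ^+ 2)%:E)%E.
  rewrite (ge0_integral_pushforward m1)//.
  by move=> y _; rewrite lee_fin sqr_ge0.
transitivity (\int[pushforward P (fun w => ip01 (X w) (phi k) : measurableTypeR R)]_y (y ^+ 2)%:E)%E; last first.
  rewrite (ge0_integral_pushforward m2)//.
  by move=> y _; rewrite lee_fin sqr_ge0.
by apply: eq_measure_integral => A mA _; exact: transfer.
Qed.

End gaussian_law.

Section observation.
Variables (R : realType) (Q : R -> probability (measurableTypeR R) R) (psi : R -> R).
Hypothesis hQ : exponential_family Q psi.
Variable Gamma : probability (L2 R) R.

Definition obs_base : probability (obs R) R := (Q 0%R \x Gamma)%E.

Definition obs_density (B : L2 R) (p : obs R) : R :=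
  expR (ip01 p.2 B * p.1 - psi (ip01 p.2 B)).

Lemma measurable_obs_expR (u v : L2 R -> R) :
  measurable_fun [set: L2 R] u -> measurable_fun [set: L2 R] v ->
  measurable_fun [set: obs R] (fun p : obs R => expR (u p.2 * p.1 - v p.2)).
Proof.
move=> mu mv; apply: measurableT_comp => //.
apply: measurable_funB; last exact: (measurableT_comp mv).
by apply: measurable_funM => //; exact: (measurableT_comp mu).
Qed.

Lemma measurable_psi_ip01 (B : L2 R) : measurable_fun [set: L2 R] (fun x : L2 R => psi (ip01 x B)).
Proof. exact: (measurableT_comp (measurable_expfam_psi hQ) (measurable_ip01 B)). Qed.

Lemma measurable_obs_density B : measurable_fun [set: obs R] (obs_density B).
Proof. exact: (measurable_obs_expR (measurable_ip01 B) (measurable_psi_ip01 B)). Qed.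

Lemma obs_density_ge0 B p : 0 <= obs_density B p.
Proof. exact: expR_ge0. Qed.

Lemma obs_density0 p : obs_density 0 p = 1.
Proof.
rewrite /obs_density ip01C ip010l mul0r sub0r.
suff -> : psi 0 = 0 by rewrite oppr0 expR0.
apply: expR_inj; rewrite expR0; apply: EFin_inj; rewrite -(expfam_mgf hQ).
under eq_integral do rewrite mul0r expR0.
by rewrite integral_cst// mul1e; exact: probability_setT.
Qed.

Lemma integral_obs_base (g : obs R -> R) :
  measurable_fun [set: obs R] g -> (forall p, 0 <= g p) ->
  (\int[obs_base]_p (g p)%:E = \int[Gamma]_x \int[Q 0%R]_y (g (y, x))%:E)%E.
Proof.
move=> mg g0.
have mg' : measurable_fun [set: obs R] (EFin \o g) by exact/measurable_EFinP.
have g0' (p : obs R) : (0 <= (EFin \o g) p)%E by rewrite lee_fin.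
transitivity (\int[Q 0%R]_y \int[Gamma]_x (g (y, x))%:E)%E.
  exact: (@fubini_tonelli1 _ _ _ _ _ (Q 0%R) Gamma (EFin \o g)).
exact: (@fubini_tonelli _ _ _ _ _ (Q 0%R) Gamma (EFin \o g)).
Qed.

Lemma integral_obs_density B (A : set (measurableTypeR R)) (S : set (L2 R)) :
  measurable A -> measurable S ->
  (\int[obs_base]_(p in A `*` S) (obs_density B p)%:E = \int[Gamma]_(x in S) Q (ip01 x B) A)%E.
Proof.
move=> mA mS.
rewrite integral_mkcond.
transitivity (\int[obs_base]_p (obs_density B p * \1_(A `*` S) p)%:E)%E.
  apply: eq_integral => p _; rewrite patchE indicE.
  by case: ifP => _; rewrite ?mulr1 ?mulr0.
rewrite integral_obs_base; last 2 first.
- apply: measurable_funM; first exact: measurable_obs_density.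
  by apply: measurable_indic; exact: measurableX.
- by move=> p; rewrite mulr_ge0 ?obs_density_ge0.
rewrite [RHS]integral_mkcond; apply: eq_integral => x _; rewrite patchE.
case: ifPn => [/set_mem xS|/negP xS].
  rewrite (hQ _ mA) [RHS]integral_mkcond; apply: eq_integral => y _; rewrite patchE indicE.
  have -> : ((y, x) \in A `*` S) = (y \in A).
    by apply/idP/idP => /set_mem h; apply/mem_set => //; case: h.
  by case: ifP => _; rewrite ?mulr1 ?mulr0.
apply: integral0_eq => y _; rewrite indicE memNset ?mulr0//.
by move=> [_ ?]; apply: xS; exact: mem_set.
Qed.

Lemma integral_obs_densityT B : (\int[obs_base]_p (obs_density B p)%:E = 1)%E.
Proof.
rewrite -setXTT integral_obs_density//.
under eq_integral do rewrite probability_setT.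
by rewrite integral_cst// mul1e; exact: probability_setT.
Qed.

(** [sample_law] describes a coordinate on products [A * S] only, through an integral over the
    sample. Pushing that integral to [Gamma] gives the density formula on products, and these form a
    generating family stable under intersection. *)
Lemma sample_law_density n (P : probability (n.-tuple (obs R)) R) (B : L2 R) (i : 'I_n)
    (E : set (obs R)) :
  sample_law Q Gamma 0 B P -> measurable E ->
  (P [set z | E (tnth z i)] = \int[obs_base]_(p in E) (obs_density B p)%:E)%E.
Proof.
move=> [_ [PX PYX]] mE.
have [nu [nuE _]] := exists_density obs_base (measurable_obs_density B) (obs_density_ge0 B).
rewrite -nuE.
have mt := @measurable_tnth _ (obs R) n i.
pose m1 : {measure set (obs R) -> \bar R} := pushforward P (fun z : n.-tuple (obs R) => tnth z i).
pose G : set (set (obs R)) := [set C | exists A S, [/\ measurable A, measurable S & C = A `*` S]].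
transitivity (m1 mt E) => //.
apply: (measure_unique G (fun=> setT)) => //.
- rewrite measurable_prod_measurableType; congr (<<s _ >>).
  apply/seteqP; split=> [_ [A mA [S mS <-]]|_ [A [S [mA mS ->]]]].
    by exists A, S.
  by exists A => //; exists S.
- move=> _ _ [A [S [mA mS ->]]] [A' [S' [mA' mS' ->]]].
  exists (A `&` A'), (S `&` S'); split; [exact: measurableI|exact: measurableI|].
  by rewrite setXI.
- by move=> _; exists setT, setT; rewrite setXTT.
- by apply/seteqP; split=> // z _; exists 0%N.
- move=> _ [A [S [mA mS ->]]].
  rewrite nuE integral_obs_density// -[LHS]/(P [set z | A (tnth z i).1 /\ S (tnth z i).2]).
  rewrite PYX//.
  under eq_integral do rewrite add0r.
  have mt2 : measurable_fun [set: n.-tuple (obs R)] (fun z : n.-tuple (obs R) => (tnth z i).2).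
    exact: (measurableT_comp measurable_snd mt).
  (* Measurability of the kernel in x comes from its density, by Tonelli. *)
  have mQ : measurable_fun [set: L2 R] (fun x : L2 R => Q (ip01 x B) A).
    have -> : (fun x : L2 R => Q (ip01 x B) A) =
        (fun x : L2 R => \int[Q 0%R]_y (obs_density B (y, x) * \1_A y)%:E)%E.
      apply/funext => x; rewrite (hQ _ mA) integral_mkcond; apply: eq_integral => y _.
      by rewrite patchE indicE; case: ifP; rewrite ?mulr1 ?mulr0.
    have mg : measurable_fun [set: obs R] (fun p : obs R => (obs_density B p * \1_A p.1)%:E).
      apply/measurable_EFinP; apply: measurable_funM; first exact: measurable_obs_density.
      by apply: measurableT_comp => //; exact: measurable_indic.
    apply: (@measurable_fun_fubini_tonelli_G _ _ _ _ _ (Q 0%R) _ mg).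
    by move=> p; rewrite lee_fin mulr_ge0 ?obs_density_ge0.
  rewrite -[LHS](@ge0_integral_pushforward _ _ _ _ _ _ mt2 P S (fun x : L2 R => Q (ip01 x B) A))//; last first.
    exact: measurable_funTS.
  by apply: eq_measure_integral => C mC CS; exact: PX.
- by move=> _; apply: (@le_lt_trans _ _ 1%E); [exact: (@probability_le1 _ _ _ P setT measurableT)|rewrite ltry].
Qed.

End observation.

(** * The two-point bound *)

Section affinity.
Variables (R : realType) (Q : R -> probability (measurableTypeR R) R) (psi : R -> R).
Hypothesis hQ : exponential_family Q psi.
Variables (Gamma : probability (L2 R) R) (K : measurableTypeR R * measurableTypeR R -> R).
Variables (theta : nat -> R) (phi : nat -> L2 R).
Hypotheses (hG : gaussian_process_law Gamma 0 K)
  (KL : K \in Lfun (@leb01 R \x @leb01 R)%E 2%:E)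
  (on : orthonormal01 phi) (ee : eigen_expansion K theta phi).

(** The square root of [obs_density], obtained by halving the exponent, so that a product of two of
    them is again an exponential in the response. *)
Definition sqrt_density (B : L2 R) (p : obs R) : R :=
  expR (ip01 p.2 B / 2 * p.1 - psi (ip01 p.2 B) / 2).

Lemma sqrt_density_sqr B p : sqrt_density B p ^+ 2 = obs_density psi B p.
Proof. by rewrite expr2 -expRD; congr expR; field. Qed.

Lemma measurable_sqrt_density B : measurable_fun [set: obs R] (sqrt_density B).
Proof.
apply: (@measurable_obs_expR _ (fun x : L2 R => ip01 x B / 2) (fun x : L2 R => psi (ip01 x B) / 2)).
  by apply: measurable_funM => //; exact: measurable_ip01.
by apply: measurable_funM => //; exact: (measurable_psi_ip01 hQ).
Qed.

(** Given X, the product of the square roots has slope [(l + l') / 2] in y; integrating y out is the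
    moment generating function at the midpoint. *)
Lemma obs_affinityE (B B' : L2 R) :
  (\int[obs_base Q Gamma]_p (sqrt_density B p * sqrt_density B' p)%:E =
   \int[Gamma]_x (expR (psi ((ip01 x B + ip01 x B') / 2) -
                        (psi (ip01 x B) + psi (ip01 x B')) / 2))%:E)%E.
Proof.
rewrite integral_obs_base; last 2 first.
- by apply: measurable_funM; exact: measurable_sqrt_density.
- by move=> p; rewrite mulr_ge0// expR_ge0.
apply: eq_integral => x _.
set l := ip01 x B; set l' := ip01 x B'.
transitivity (\int[Q 0%R]_y ((expR (- ((psi l + psi l') / 2)))%:E * (expR ((l + l') / 2 * y))%:E))%E.
  apply: eq_integral => y _; rewrite -EFinM -!expRD; congr (expR _)%:E.
  by rewrite /l /l'/=; field.
rewrite ge0_integralZl//.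
- rewrite [X in _ = (expR X)%:E]addrC expRD EFinM; congr (_ * _)%E.
  exact: (expfam_mgf hQ ((l + l') / 2)).
- by apply/measurable_EFinP; apply: measurableT_comp => //; exact: measurable_funM.
Qed.

Lemma obs_affinity_ge : exists2 C : R, 0 < C &
  forall (B B' : L2 R) (b delta : R) (k : nat), 0 < b -> ip01 B B <= b -> ip01 B' B' <= b ->
  (forall x : L2 R, ip01 x B - ip01 x B' = delta * ip01 x (phi k)) ->
  exists2 a : R, (\int[obs_base Q Gamma]_p (sqrt_density B p * sqrt_density B' p)%:E = a%:E)%E &
    1 - C * (delta ^+ 2 * theta k + b ^+ 2) <= a.
Proof.
have [C0 C00 HC0] := expfam_affinity_ge hQ.
have [C1 C10 [tail sqr]] := gaussian_law_bounds hG KL on ee.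
exists (C0 + 2 * C1); first by rewrite addr_gt0// mulr_gt0.
move=> B B' b delta k b0 hB hB' hBB'.
have fin : (\int[obs_base Q Gamma]_p (sqrt_density B p * sqrt_density B' p)%:E)%E \is a fin_num.
  rewrite ge0_fin_numE; last by apply: integral_ge0 => p _; rewrite lee_fin mulr_ge0// expR_ge0.
  have m1 := measurable_sqrt_density B; have m2 := measurable_sqrt_density B'.
  apply: le_lt_trans (@ge0_integral_le_lin3 _ _ _ (obs_base Q Gamma)
    (fun p => sqrt_density B p * sqrt_density B' p) (obs_density psi B) (obs_density psi B') (fun=> 0)
    1 1 0 _ _ _ _ _ _ _ _ _ _ _ _) _ => //.
  - exact: measurable_funM.
  - exact: (measurable_obs_density hQ).
  - exact: (measurable_obs_density hQ).
  - by move=> p; rewrite mulr_ge0// expR_ge0.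
  - by move=> p; exact: obs_density_ge0.
  - by move=> p; exact: obs_density_ge0.
  - move=> p; rewrite !mul1r mul0r addr0 -!sqrt_density_sqr.
    have := sqr_ge0 (sqrt_density B p - sqrt_density B' p).
    rewrite sqrrB addrAC subr_ge0; apply: le_trans.
    by rewrite mulr2n lerDl mulr_ge0// expR_ge0.
  - by rewrite !(integral_obs_densityT hQ) !mul1e mul0e adde0 -EFinD ltry.
exists (fine (\int[obs_base Q Gamma]_p (sqrt_density B p * sqrt_density B' p)%:E)%E).
  by rewrite fineK.
set a := fine _.
pose Af (x : L2 R) := expR (psi ((ip01 x B + ip01 x B') / 2) -
                        (psi (ip01 x B) + psi (ip01 x B')) / 2).
have aE : (\int[Gamma]_x (Af x)%:E = a%:E)%E by rewrite -obs_affinityE fineK.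
pose S (h : L2 R) := [set x : L2 R | 1 < `|ip01 x h|].
have mS h : measurable (S h).
  have mh : measurable_fun [set: L2 R] (fun x : L2 R => ip01 x h : R) by exact: measurable_ip01.
  rewrite -[X in measurable X]setTI; apply: measurable_fun_ltr => //.
  exact: measurableT_comp.
have mip (h : L2 R) : measurable_fun [set: L2 R] (fun x : L2 R => ip01 x h : R) by apply: measurable_ip01.
have mpsi (h : L2 R) : measurable_fun [set: L2 R] (fun x : L2 R => psi (ip01 x h)).
  exact: (measurable_psi_ip01 hQ).
have mAf : measurable_fun [set: L2 R] Af.
  apply: measurableT_comp => //; apply: measurable_funB.
    apply: (measurableT_comp (measurable_expfam_psi hQ)).
    by apply: measurable_funM => //; exact: measurable_funD.
  by apply: measurable_funM => //; exact: measurable_funD.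
have I1 : (\int[Gamma]_x (1 : R)%:E = 1)%E.
  by rewrite integral_cst// mul1e; exact: probability_setT.
have SE : (\int[Gamma]_x (\1_(S B) x + \1_(S B') x)%:E <= (2 * C1 * b ^+ 2)%:E)%E.
  under eq_integral do rewrite EFinD.
  rewrite ge0_integralD//; [|exact/measurable_EFinP/measurable_indic|exact/measurable_EFinP/measurable_indic].
  rewrite !integral_indic// !setIT.
  have -> : 2 * C1 * b ^+ 2 = C1 * b ^+ 2 + C1 * b ^+ 2 by ring.
  by rewrite EFinD; apply: leeD; exact: tail.
(* Pointwise, 1 is at most the conditional affinity plus [C0] times the squared difference of the
   predictors, plus the indicators of the events where a predictor leaves [-1, 1]. *)
have H : (1 <= a%:E + (C0 * delta ^+ 2)%:E * (theta k)%:E + (2 * C1 * b ^+ 2)%:E)%E.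
  rewrite -I1 -aE -sqr.
  apply: (le_trans (@ge0_integral_le_lin3 _ _ _ Gamma (fun=> 1) Af (fun x => ip01 x (phi k) ^+ 2)
    (fun x => \1_(S B) x + \1_(S B') x) 1 (C0 * delta ^+ 2) 1 _ _ _ _ _ _ _ _ _ _ _ _)) => //.
  - exact: measurable_funX.
  - by apply: measurable_funD; exact: measurable_indic.
  - by move=> x; exact: expR_ge0.
  - by move=> x; exact: sqr_ge0.
  - by rewrite mulr_ge0 ?sqr_ge0// ltW.
  - move=> x; rewrite !mul1r.
    have A0 : 0 <= Af x by exact: expR_ge0.
    have c0 : 0 <= C0 * delta ^+ 2 * ip01 x (phi k) ^+ 2.
      by rewrite mulr_ge0 ?sqr_ge0// mulr_ge0 ?sqr_ge0// ltW.
    rewrite !indicE.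
    have [xB|xB] := boolP (x \in S B).
      by rewrite -[leLHS]add0r lerD ?addr_ge0// lerDl ler0n.
    have [xB'|xB'] := boolP (x \in S B').
      by rewrite -[leLHS]add0r lerD ?addr_ge0// lerDr ler0n.
    have lB : `|ip01 x B| <= 1 by rewrite leNgt; apply: contra xB => ?; apply/mem_set.
    have lB' : `|ip01 x B'| <= 1 by rewrite leNgt; apply: contra xB' => ?; apply/mem_set.
    have := HC0 _ _ lB lB'.
    by rewrite hBB' exprMn -/(Af x) /= addr0 addr0 mulrA lerBlDr.
  - by rewrite mul1e mul1e; apply: leeD.
move: H; rewrite -EFinM -!EFinD lee_fin => H.
have := hBB' (phi k); rewrite on eqxx mulr1 => _.
have th0 : 0 <= theta k.
  by rewrite -lee_fin -sqr; apply: integral_ge0 => x _; rewrite lee_fin sqr_ge0.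
have p1 : 0 <= C1 * (delta ^+ 2 * theta k).
  by apply: mulr_ge0; [exact: ltW|apply: mulr_ge0 => //; exact: sqr_ge0].
have p2 : 0 <= C0 * b ^+ 2 by apply: mulr_ge0; [exact: ltW|exact: sqr_ge0].
rewrite lerBlDr (le_trans H)// -addrA lerD2l.
have -> : (C0 + 2 * C1) * (delta ^+ 2 * theta k + b ^+ 2) =
    C0 * delta ^+ 2 * theta k + 2 * C1 * b ^+ 2 + (C0 * b ^+ 2 + 2 * (C1 * (delta ^+ 2 * theta k))).
  by ring.
by rewrite lerDl addr_ge0// mulr_ge0.
Qed.

End affinity.

(** With [W = U^2 + V^2], the minimum over [t] of the first two terms is [delta^2 * (U * V)^2 / W],
    at [t = delta * U^2 / W]. By the arithmetic-geometric mean inequality, adding [delta^2 * W / 16]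
    gives at least [delta^2 * U * V / 2]. *)
Lemma two_point_pointwise (R : realFieldType) (U V t delta : R) : 0 <= U -> 0 <= V ->
  delta ^+ 2 / 4 * (U * V) <=
  (delta - t) ^+ 2 * U ^+ 2 + t ^+ 2 * V ^+ 2 + delta ^+ 2 / 16 * (U ^+ 2 + V ^+ 2).
Proof.
move=> U0 V0; have [W0|W0] := eqVneq (U ^+ 2 + V ^+ 2) 0.
  have UV0 : U = 0.
    by apply/eqP; rewrite -sqrf_eq0; move/eqP: W0; rewrite paddr_eq0 ?sqr_ge0// => /andP[].
  by rewrite W0 UV0 mul0r !mulr0 addr0 addr_ge0// mulr_ge0 ?sqr_ge0.
have {}W0 : 0 < U ^+ 2 + V ^+ 2 by rewrite lt_def W0 addr_ge0 ?sqr_ge0.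
rewrite -subr_ge0 -(pmulr_rge0 _ W0).
have -> : (U ^+ 2 + V ^+ 2) * ((delta - t) ^+ 2 * U ^+ 2 + t ^+ 2 * V ^+ 2 +
    delta ^+ 2 / 16 * (U ^+ 2 + V ^+ 2) - delta ^+ 2 / 4 * (U * V)) =
  ((U ^+ 2 + V ^+ 2) * t - delta * U ^+ 2) ^+ 2 + (delta * (U * V - (U ^+ 2 + V ^+ 2) / 4)) ^+ 2 +
    delta ^+ 2 / 4 * (U * V) * (U ^+ 2 + V ^+ 2) by field.
apply: addr_ge0; first by rewrite addr_ge0 ?sqr_ge0.
by apply: mulr_ge0; [apply: mulr_ge0; [rewrite mulr_ge0 ?sqr_ge0|exact: mulr_ge0]|exact: ltW].
Qed.

(** A two-point bound for squared loss in affinity form: the target is [delta] under the density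
    [u^2] and 0 under [v^2]. Integrating [two_point_pointwise] leaves [delta^2 * (a / 4 - 1 / 8)],
    at least [delta^2 / 16] when [a >= 3 / 4]. *)
Lemma two_point_integral d (T : measurableType d) (R : realType) (mu : {measure set T -> \bar R})
    (u v t : T -> R) (a delta : R) :
  measurable_fun [set: T] u -> measurable_fun [set: T] v -> measurable_fun [set: T] t ->
  (forall x, 0 <= u x) -> (forall x, 0 <= v x) ->
  (\int[mu]_x (u x ^+ 2)%:E = 1)%E -> (\int[mu]_x (v x ^+ 2)%:E = 1)%E ->
  (\int[mu]_x (u x * v x)%:E = a%:E)%E -> 3 / 4 <= a ->
  ((delta ^+ 2 / 16)%:E <=
    \int[mu]_x ((delta - t x) ^+ 2 * u x ^+ 2)%:E + \int[mu]_x (t x ^+ 2 * v x ^+ 2)%:E)%E.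
Proof.
move=> mu_ mv mt u0 v0 u1 v1 uv a34.
have mu2 : measurable_fun [set: T] (fun z => u z ^+ 2) by exact: measurable_funX.
have mv2 : measurable_fun [set: T] (fun z => v z ^+ 2) by exact: measurable_funX.
have muv : measurable_fun [set: T] (fun z => u z * v z) by exact: measurable_funM.
have mg1 : measurable_fun [set: T] (fun z => (delta - t z) ^+ 2 * u z ^+ 2).
  by apply: measurable_funM => //; apply: measurable_funX; exact: measurable_funB.
have mg2 : measurable_fun [set: T] (fun z => t z ^+ 2 * v z ^+ 2).
  by apply: measurable_funM => //; exact: measurable_funX.
have mg3 : measurable_fun [set: T] (fun z => u z ^+ 2 + v z ^+ 2) by exact: measurable_funD.
have mf : measurable_fun [set: T] (fun z => delta ^+ 2 / 4 * (u z * v z)) by exact: measurable_funM.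
have uv2 : (\int[mu]_x (u x ^+ 2 + v x ^+ 2)%:E = 2%:E)%E.
  under eq_integral do rewrite EFinD.
  rewrite ge0_integralD//.
  - by rewrite u1 v1 -EFinD.
  - by move=> x _; rewrite lee_fin sqr_ge0.
  - exact/measurable_EFinP.
  - by move=> x _; rewrite lee_fin sqr_ge0.
  - exact/measurable_EFinP.
have d4 : 0 <= delta ^+ 2 / 4 by rewrite divr_ge0 ?sqr_ge0.
have d16 : 0 <= delta ^+ 2 / 16 by rewrite divr_ge0 ?sqr_ge0.
have := @ge0_integral_le_lin3 _ _ _ mu _ _ _ _ 1 1 (delta ^+ 2 / 16) mf mg1 mg2 mg3.
have -> : (\int[mu]_x (delta ^+ 2 / 4 * (u x * v x))%:E = (delta ^+ 2 / 4 * a)%:E)%E.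
  under eq_integral do rewrite EFinM.
  rewrite ge0_integralZl// ?uv ?EFinM//; first exact/measurable_EFinP.
  by move=> x _; rewrite lee_fin mulr_ge0.
rewrite uv2 !mul1e => H.
have {}H := H (fun x => mulr_ge0 d4 (mulr_ge0 (u0 x) (v0 x)))
  (fun x => mulr_ge0 (sqr_ge0 _) (sqr_ge0 _)) (fun x => mulr_ge0 (sqr_ge0 _) (sqr_ge0 _))
  (fun x => addr_ge0 (sqr_ge0 _) (sqr_ge0 _)) ler01 ler01 d16.
set I1 := (\int[mu]_x ((delta - t x) ^+ 2 * _)%:E)%E in H *.
set I2 := (\int[mu]_x (t x ^+ 2 * _)%:E)%E in H *.
have I10 : (0 <= I1)%E by apply: integral_ge0 => x _; rewrite lee_fin mulr_ge0 ?sqr_ge0.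
have I20 : (0 <= I2)%E by apply: integral_ge0 => x _; rewrite lee_fin mulr_ge0 ?sqr_ge0.
have {H} : ((delta ^+ 2 / 4 * a)%:E <= I1 + I2 + (delta ^+ 2 / 16 * 2)%:E)%E.
  by rewrite EFinM; apply: H => x; rewrite !mul1r; exact: two_point_pointwise.
have : delta ^+ 2 / 4 * (3 / 4) <= delta ^+ 2 / 4 * a by rewrite ler_wpM2l.
move: (delta ^+ 2 / 4 * a) I10 I20 => c; case: I1 => [i1||]// _; case: I2 => [i2||]// _ h.
  by rewrite -!EFinD !lee_fin => ?; lra.
all: by move=> _; rewrite leey.
Qed.

Section two_point.
Variables (R : realType) (Q : R -> probability (measurableTypeR R) R) (psi : R -> R).
Hypothesis hQ : exponential_family Q psi.
Variables (Gamma : probability (L2 R) R) (n : nat).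
Local Notation P_ := (probability (n.-tuple (obs R)) R).
Variable P0 : P_.
Hypothesis hP0 : sample_law Q Gamma 0 0 P0.

Lemma sample_law_rectangle (P : P_) (B : L2 R) (E : 'I_n -> set (obs R)) :
  sample_law Q Gamma 0 B P -> (forall i, measurable (E i)) ->
  P (rectangle E) = (\prod_(i < n) \int[obs_base Q Gamma]_(p in E i) (obs_density psi B p)%:E)%E.
Proof.
move=> hP mE; rewrite -[LHS]/(P [set z | forall i, E i (tnth z i)]) hP.1//.
by apply: eq_bigr => i _; rewrite (sample_law_density hQ i hP).
Qed.

Lemma sample_law0_rectangle (E : 'I_n -> set (obs R)) : (forall i, measurable (E i)) ->
  P0 (rectangle E) = (\prod_(i < n) obs_base Q Gamma (E i))%E.
Proof.
move=> mE; rewrite (sample_law_rectangle hP0)//; apply: eq_bigr => i _.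
under eq_integral do rewrite (obs_density0 hQ).
by rewrite integral_cst// mul1e.
Qed.

Lemma sample_law_change (P : P_) (B : L2 R) (g : n.-tuple (obs R) -> R) :
  sample_law Q Gamma 0 B P -> measurable_fun [set: n.-tuple (obs R)] g -> (forall z, 0 <= g z) ->
  (\int[P]_z (g z)%:E =
   \int[P0]_z (g z * (\prod_(i < n) sqrt_density psi B (tnth z i)) ^+ 2)%:E)%E.
Proof.
move=> hP mg g0.
rewrite (@tuple_change_of_measure _ _ _ _ P0 (obs_base Q Gamma) _ P (obs_density psi B) (EFin \o g)).
- apply: eq_integral => z _; rewrite -EFinM -prodrXl; congr (_ * _)%:E.
  by apply: eq_bigr => i _; rewrite sqrt_density_sqr.
- exact: sample_law0_rectangle.
- exact: (measurable_obs_density hQ).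
- exact: obs_density_ge0.
- by rewrite (integral_obs_densityT hQ) ltry.
- by move=> E mE; exact: sample_law_rectangle.
- exact/measurable_EFinP.
- by move=> z; rewrite lee_fin.
Qed.

(** Under the dominating law [P0] the observations are independent, so the affinity of the two
    samples is the [n]-th power of [a]. *)
Lemma two_point_risk (P P' : P_) (B B' : L2 R) (T : n.-tuple (obs R) -> R) (a delta : R) :
  sample_law Q Gamma 0 B P -> sample_law Q Gamma 0 B' P' ->
  measurable_fun [set: n.-tuple (obs R)] T ->
  (\int[obs_base Q Gamma]_p (sqrt_density psi B p * sqrt_density psi B' p)%:E = a%:E)%E ->
  3 / 4 <= a ^+ n ->
  ((delta ^+ 2 / 16)%:E <=
    \int[P]_z ((delta - T z) ^+ 2)%:E + \int[P']_z (T z ^+ 2)%:E)%E.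
Proof.
move=> hP hP' mT aE an.
pose u z := \prod_(i < n) sqrt_density psi B (tnth z i).
pose v z := \prod_(i < n) sqrt_density psi B' (tnth z i).
have mdT : measurable_fun [set: n.-tuple (obs R)] (fun z => (delta - T z) ^+ 2).
  by apply: measurable_funX; exact: measurable_funB.
have mT2 : measurable_fun [set: n.-tuple (obs R)] (fun z => T z ^+ 2).
  exact: measurable_funX.
rewrite (sample_law_change hP mdT); last by move=> z; exact: sqr_ge0.
rewrite (sample_law_change hP' mT2); last by move=> z; exact: sqr_ge0.
have one (P1 : P_) B1 : sample_law Q Gamma 0 B1 P1 ->
    (\int[P0]_z ((\prod_(i < n) sqrt_density psi B1 (tnth z i)) ^+ 2)%:E = 1)%E.
  move=> h1; transitivity (\int[P1]_z (1 : R)%:E)%E; last first.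
    by rewrite integral_cst// mul1e; exact: probability_setT.
  rewrite (sample_law_change (g := fun=> 1) h1)//.
  by apply: eq_integral => z _; rewrite mul1r.
apply: (@two_point_integral _ _ _ P0 u v T (a ^+ n) delta) => //.
- apply: (@measurable_tuple_prod _ _ _ _ (fun=> sqrt_density psi B) xpredT) => i.
  exact: (measurable_sqrt_density hQ).
- apply: (@measurable_tuple_prod _ _ _ _ (fun=> sqrt_density psi B') xpredT) => i.
  exact: (measurable_sqrt_density hQ).
- by move=> z; apply: prodr_ge0 => i _; exact: expR_ge0.
- by move=> z; apply: prodr_ge0 => i _; exact: expR_ge0.
- exact: (one P).
- exact: (one P').
transitivity (\int[P0]_z (\prod_(i < n) (fun p => sqrt_density psi B p * sqrt_density psi B' p) (tnth z i))%:E)%E.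
  by apply: eq_integral => z _; rewrite /u /v -big_split.
rewrite (@integral_tuple_prod _ _ _ _ P0 (obs_base Q Gamma) _
  (fun _ p => sqrt_density psi B p * sqrt_density psi B' p) (fun=> a))//.
- by rewrite prodr_const card_ord.
- exact: sample_law0_rectangle.
- by move=> i; apply: measurable_funM; exact: (measurable_sqrt_density hQ).
- by move=> i p; rewrite mulr_ge0// expR_ge0.
Qed.

End two_point.

(** * Assouad's hypercube *)

(** The integral of a nonnegative function is a supremum over the simple functions below it, hence
    monotone for arbitrary functions. It serves to bound the risk below, the loss not having been
    shown measurable in the sample. *)
Lemma ge0_le_integral_nonmeasurable d (T : measurableType d) (R : realType)
    (mu : {measure set T -> \bar R}) (f g : T -> \bar R) :
  (forall x, (0 <= f x)%E) -> (forall x, (f x <= g x)%E) ->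
  (\int[mu]_x f x <= \int[mu]_x g x)%E.
Proof.
move=> f0 fg; rewrite !ge0_integralTE//; last by move=> x; exact: le_trans (fg x).
apply: le_ereal_sup => _ [h hf <-]; exists h => // x.
exact: le_trans (fg x).
Qed.

Section hypercube.
Variables (R : realType) (phi : nat -> L2 R) (m : nat) (delta : R).
Hypothesis on : orthonormal01 phi.
Implicit Types (g : {ffun 'I_m -> bool}) (i : 'I_m).

(** Counted from 1, the indices are m+1 to 2m. Being at most 2m they allow coefficients of order
    m^-beta, and being above m they keep the eigenvalues of order at most m^-alpha. *)
Definition cube g : L2 R := \sum_(i < m) (delta * (g i)%:R) *: phi (m + i)%N.

Definition flip i g : {ffun 'I_m -> bool} := [ffun j => if j == i then ~~ g j else g j].

Lemma flipK i : involutive (flip i).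
Proof. by move=> g; apply/ffunP => j; rewrite !ffunE; case: eqP => // _; rewrite negbK. Qed.

Lemma ip01_cubel g (x : L2 R) : ip01 (cube g) x = \sum_(i < m) delta * (g i)%:R * ip01 (phi (m + i)%N) x.
Proof. by rewrite ip01_suml; apply: eq_bigr => i _; rewrite ip01Zl. Qed.

Lemma ip01_cube_phi g i : ip01 (cube g) (phi (m + i)%N) = delta * (g i)%:R.
Proof.
rewrite ip01_cubel (bigD1 i)//= on eqxx mulr1 big1 ?addr0// => j ji.
by rewrite on eqn_add2l -val_eqE/= in ji *; rewrite (negbTE ji) mulr0.
Qed.

Lemma ip01_cube_le g : ip01 (cube g) (cube g) <= m%:R * delta ^+ 2.
Proof.
rewrite ip01_cubel (eq_bigr (fun i => (delta * (g i)%:R) ^+ 2)); last first.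
  by move=> i _; rewrite ip01C ip01_cube_phi expr2.
apply: (@le_trans _ _ (\sum_(i < m) delta ^+ 2)); last by rewrite sumr_const card_ord mulr_natl.
apply: ler_sum => i _; case: (g i) => /=; first by rewrite mulr1.
by rewrite mulr0 expr0n/= sqr_ge0.
Qed.

Lemma ip01_cube_flip g i (x : L2 R) : g i ->
  ip01 x (cube g) - ip01 x (cube (flip i g)) = delta * ip01 x (phi (m + i)%N).
Proof.
move=> gi; rewrite ![ip01 x _]ip01C !ip01_cubel -sumrB (bigD1 i)//= ffunE eqxx gi mulr1 mulr0 mul0r subr0.
by rewrite big1 ?addr0// => j /negbTE ji; rewrite ffunE ji subrr.
Qed.

Lemma norm01_0 : norm01 (0 : L2 R) = 0.
Proof. by apply/eqP; rewrite -sqrf_eq0 norm01_sqr ip010l. Qed.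

Lemma cube_paramF r alpha beta theta K g :
  0 < r -> 0 <= beta -> 0 <= delta -> delta <= r * (2 * m)%:R `^ (- beta) ->
  covariance_kernel K -> K \in Lfun (@leb01 R \x @leb01 R)%E 2%:E ->
  eigen_expansion K theta phi ->
  (forall k : nat, theta k <= r * k.+1%:R `^ (- alpha)) ->
  (forall k : nat, theta k.+1 + alpha / r * k.+1%:R `^ (- alpha - 1) <= theta k) ->
  paramF r alpha beta (Param K 0 0 (cube g)).
Proof.
move=> r0 beta0 d0 dle cK KL ee th1 th2.
(* At most one term is present: [delta * g i] when [k] is [m + i], and the empty sum otherwise. *)
pose b (k : nat) := \sum_(i < m | (m + i == k)%N) delta * (g i)%:R.
exists theta, phi, b; split; first by [].
split; first by rewrite /= normr0 ltW.
split; first by rewrite /= norm01_0 ltW.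
split.
  (* From [2 * m] on, the partial sums coincide with the cube point. *)
  apply: cvg_near_cst; exists (2 * m)%N => // N /= mN.
  rewrite -[RHS]norm01_0; congr norm01; apply/funext => t /=.
  apply/eqP; rewrite subr_eq0; apply/eqP; rewrite L2_sumE.
  under [RHS]eq_bigr => k _.
    rewrite /b mulr_suml; under eq_bigr => i /eqP <- do [].
    over.
  rewrite (exchange_big_dep xpredT)//=; apply: eq_bigr => i _.
  have iN : (m + i < N)%N by rewrite (leq_trans _ mN)// mul2n -addnn ltn_add2l.
  by rewrite (big_pred1 (Ordinal iN)).
move=> k; rewrite /b.
have [/existsP[i /eqP ik]|/existsPn nk] := boolP [exists i : 'I_m, (m + i == k)%N].
  rewrite (big_pred1 i); last by move=> j; rewrite -ik eqn_add2l.
  have kle : (k.+1 <= 2 * m)%N by rewrite -ik -addnS mul2n -addnn leq_add2l.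
  apply: (@le_trans _ _ delta).
    by rewrite normrM (ger0_norm d0) ler_piMr// normr_nat lern1; case: (g i).
  apply: (le_trans dle); rewrite ler_pM2l// !powRN lef_pV2 ?posrE ?powR_gt0 ?ltr0n//.
    by apply: ge0_ler_powR => //; rewrite ?nnegrE ?ler0n// ler_nat.
  by apply: leq_trans kle.
rewrite big_pred0; last by move=> j; exact/negbTE/nk.
by rewrite normr0 mulr_ge0 ?powR_ge0// ltW.
Qed.

End hypercube.

Section assouad.
Variables (R : realType) (Q : R -> probability (measurableTypeR R) R) (psi : R -> R).
Hypothesis hQ : exponential_family Q psi.
Variables (Gamma : probability (L2 R) R) (n : nat).
Local Notation P_ := (probability (n.-tuple (obs R)) R).
Variables (P0 : P_) (phi : nat -> L2 R) (m : nat) (delta : R).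
Hypothesis hP0 : sample_law Q Gamma 0 0 P0.
Hypothesis on : orthonormal01 phi.
Variable P : {ffun 'I_m -> bool} -> P_.
Hypothesis hP : forall g, sample_law Q Gamma 0 (cube phi delta g) (P g).
Variable Bh : n.-tuple (obs R) -> L2 R.
Hypothesis mBh : measurable_fun [set: n.-tuple (obs R)] Bh.
Hypothesis haff : forall (g : {ffun 'I_m -> bool}) (i : 'I_m), g i -> exists2 a : R,
  (\int[obs_base Q Gamma]_p (sqrt_density psi (cube phi delta g) p *
      sqrt_density psi (cube phi delta (flip i g)) p)%:E = a%:E)%E & 3 / 4 <= a ^+ n.

(** Bessel's inequality reduces the loss to the [m] perturbed coordinates. Summed over the cube, the
    coordinate risks are unchanged by flipping, so twice their sum is at least [delta^2 / 16] for
    each vertex and each coordinate, while the sum itself is at most [S] per vertex. This gives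
    1/32. *)
Lemma assouad (S : \bar R) :
  (forall g, 'E_(P g)[fun z => (norm01 (cube phi delta g \- Bh z) ^+ 2)%R] <= S)%E ->
  ((m%:R * delta ^+ 2 / 32)%:E <= S)%E.
Proof.
move=> hS.
pose T (i : 'I_m) z := ip01 (Bh z) (phi (m + i)%N).
have mT i : measurable_fun [set: n.-tuple (obs R)] (T i).
  exact: (measurableT_comp (measurable_ip01 (phi (m + i)%N)) mBh).
pose e (g : {ffun 'I_m -> bool}) (i : 'I_m) := (\int[P g]_z ((delta * (g i)%:R - T i z) ^+ 2)%:E)%E.
have e0 g i : (0 <= e g i)%E by apply: integral_ge0 => z _; rewrite lee_fin sqr_ge0.
have eS g : (\sum_(i < m) e g i <= S)%E.
  apply: le_trans (hS g); rewrite expectation.unlock -ge0_integral_sum//; last 2 first.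
  - move=> i; apply/measurable_EFinP; apply: measurable_funX.
    exact: measurable_funB.
  - by move=> i z _; rewrite lee_fin sqr_ge0.
  apply: ge0_le_integral_nonmeasurable => z.
    by apply: sume_ge0 => i _; rewrite lee_fin sqr_ge0.
  rewrite sumEFin lee_fin -[X in norm01 X]/((cube phi delta g - Bh z : L2 R) : R -> R) norm01_sqr.
  have inj : injective (fun i : 'I_m => (m + i)%N) by move=> i j /addnI/val_inj.
  apply: le_trans (bessel01 (cube phi delta g - Bh z) on inj).
  by apply: ler_sum => i _; rewrite ip01Bl ip01_cube_phi.
have e2t (g : {ffun 'I_m -> bool}) i : g i -> ((delta ^+ 2 / 16)%:E <= e g i + e (flip i g) i)%E.
  move=> gi; have [a aE an] := haff gi.
  have -> : e (flip i g) i = (\int[P (flip i g)]_z (T i z ^+ 2)%:E)%E.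
    by apply: eq_integral => z _; rewrite ffunE eqxx gi mulr0 sub0r sqrrN.
  have := two_point_risk hQ hP0 delta (hP g) (hP (flip i g)) (mT i) aE an.
  by rewrite /e gi mulr1.
have e2 (g : {ffun 'I_m -> bool}) i : ((delta ^+ 2 / 16)%:E <= e g i + e (flip i g) i)%E.
  have [gi|gi] := boolP (g i); first exact: e2t.
  by rewrite addeC -{2}(flipK i g); apply: e2t; rewrite ffunE eqxx.
have flipE : (\sum_g \sum_(i < m) e (flip i g) i = \sum_g \sum_(i < m) e g i)%E.
  rewrite exchange_big/= [RHS]exchange_big/=; apply: eq_bigr => i _.
  by rewrite [RHS](reindex_inj (inv_inj (flipK i))).
pose M := #|{ffun 'I_m -> bool}|.
have M0 : (0 < M)%N by apply/card_gt0P; exists [ffun=> true].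
have lower : ((M%:R * (m%:R * (delta ^+ 2 / 16)))%:E <=
    \sum_g \sum_(i < m) e g i + \sum_g \sum_(i < m) e g i)%E.
  rewrite -{2}flipE -big_split/=.
  apply: (@le_trans _ _ (\sum_(g : {ffun 'I_m -> bool}) \sum_(i < m) (delta ^+ 2 / 16)%:E)%E).
    rewrite (eq_bigr (fun=> (m%:R * (delta ^+ 2 / 16))%:E)).
      by rewrite sumEFin sumr_const mulr_natl.
    by move=> g _; rewrite sumEFin sumr_const card_ord mulr_natl.
  by apply: lee_sum => g _; rewrite -big_split/=; apply: lee_sum => i _.
have upper : (\sum_g \sum_(i < m) e g i <= \sum_(g : {ffun 'I_m -> bool}) S)%E.
  by apply: lee_sum => g _.
have := le_trans lower (leeD upper upper).
have S0 : (0 <= S)%E by apply: le_trans (eS [ffun=> true]); exact: sume_ge0.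
case: S S0 {hS eS upper} => [s||]//= _; last by move=> _; rewrite leey.
rewrite sumEFin -EFinD !lee_fin sumr_const -mulr_natl -/M => h.
have M0' : 0 < M%:R :> R by rewrite ltr0n.
by rewrite -(ler_pM2l M0'); lra.
Qed.

End assouad.

(** * The rate *)

Lemma bernoulli_ge (R : realDomainType) (t : R) (n : nat) : 0 <= t -> t <= 1 ->
  1 - n%:R * t <= (1 - t) ^+ n.
Proof.
move=> t0 t1; elim: n => [|n IH]; first by rewrite mul0r subr0 expr0.
rewrite exprS; apply: (@le_trans _ _ ((1 - t) * (1 - n%:R * t))); last first.
  by rewrite ler_wpM2l// subr_ge0.
have n0 : 0 <= n%:R * t * t by rewrite !mulr_ge0.
by rewrite -natr1; lra.
Qed.

Lemma limn_einf_ge (R : realType) (u : (\bar R)^nat) (c : \bar R) (N : nat) :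
  (forall n, (N <= n)%N -> (c <= u n)%E) -> (c <= limn_einf u)%E.
Proof.
move=> cu; rewrite limn_einf_lim; apply: lime_ge; first exact: is_cvg_einfs.
exists N => // n /= Nn; apply: le_ereal_inf_tmp => _ [k /= nk <-].
by apply: cu; exact: leq_trans nk.
Qed.

(** [m] is n^(1/s) rounded up; as n^(1/s) is at least 1, rounding at most doubles it. *)
Lemma dimension_choice (R : realType) (s : R) (n : nat) : 0 < s -> (0 < n)%N ->
  exists2 m : nat, (0 < m)%N & n%:R <= m%:R `^ s /\ m%:R <= 2 * n%:R `^ s^-1 :> R.
Proof.
move=> s0 n0; pose x : R := n%:R `^ s^-1.
have x1 : 1 <= x.
  have e1 : (1 : R) `^ s^-1 = 1 by rewrite powR1.
  rewrite -[leLHS]e1; apply: ge0_ler_powR; rewrite ?invr_ge0 ?nnegrE ?(ltW s0) ?ler01 ?ler0n//.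
  by rewrite ler1n.
exists (Num.truncn x).+1 => //; split.
  have -> : n%:R = x `^ s by rewrite -powRrM mulVf ?gt_eqF// powRr1.
  apply: ge0_ler_powR; rewrite ?nnegrE ?powR_ge0 ?ltW//.
  exact: truncnS_gt.
have : (Num.truncn x)%:R <= x by rewrite truncn_le (le_trans _ x1).
by rewrite -natr1 -/x; move: x x1 => y y1 h; lra.
Qed.

(** [e] scales the perturbation: [e <= u] will keep the cube inside the parameter set, and the
    second bound keeps the total loss of affinity below 1/4. For [e <= 1] the bracket is at most
    [e * (r + 1)]. *)
Lemma radius_choice (R : realType) (C r u : R) : 0 < C -> 0 < r -> 0 < u ->
  exists2 e : R, 0 < e & e <= u /\ C * (e ^+ 2 * r + e ^+ 4) <= 1 / 4.
Proof.
move=> C0 r0 u0; pose c := (4 * C * (r + 1))^-1.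
have c0 : 0 < c by rewrite invr_gt0 !mulr_gt0// addr_gt0.
have [e [e0 e1 eu ec]] : exists e : R, [/\ 0 < e, e <= 1, e <= u & e <= c].
  exists (Num.min 1 (Num.min u c)).
  by rewrite !lt_min !ge_min ltr01 u0 c0 !lexx !orbT.
exists e => //; split => //.
have e2 : e ^+ 2 <= e by rewrite expr2 ler_piMr// ltW.
have e4 : e ^+ 4 <= e ^+ 2 by apply: ler_wiXn2l => //; exact: ltW.
have -> : 1 / 4 = C * (c * (r + 1)).
  by rewrite /c; field; rewrite !gt_eqF// addr_gt0.
rewrite ler_pM2l// mulrDr mulr1 lerD//; last exact: le_trans (le_trans e2 ec).
by rewrite ler_pM2r// (le_trans e2).
Qed.

(* [x] is the dimension of the hypercube and [x ^ (alpha + 2 beta)] bounds the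
   sample size; the right-hand side does not depend on [x]. *)
Lemma perturbation_budget (R : realType) (alpha beta r e x : R) :
  alpha + 2 <= 2 * beta -> 1 <= x -> 0 <= e ->
  x `^ (alpha + 2 * beta) * ((e * x `^ (- beta)) ^+ 2 * (r * x `^ (- alpha))
    + (x * (e * x `^ (- beta)) ^+ 2) ^+ 2) <= e ^+ 2 * r + e ^+ 4.
Proof.
move=> ab x1 e0; set s := alpha + 2 * beta; set delta := e * _.
have x0 : 0 < x by exact: lt_le_trans x1.
have nz : x != 0 by rewrite gt_eqF.
have d2 : delta ^+ 2 = e ^+ 2 * x `^ (- (2 * beta)).
  rewrite /delta exprMn -[(x `^ _) ^+ 2]powR_mulrn ?powR_ge0// -powRrM.
  by congr (_ * _ `^ _); ring.
have E1 : x `^ s * (x `^ (- (2 * beta)) * x `^ (- alpha)) = 1.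
  rewrite -!powRD ?nz ?implybT// (_ : s + _ = 0) ?powRr0//.
  by rewrite /s; ring.
(* The exponents add up to alpha + 2 - 2 beta, nonpositive by [ab]: the price of leaving [-1, 1]
   stays bounded. *)
have E2 : x `^ s * (x * x `^ (- (2 * beta))) ^+ 2 <= 1.
  rewrite -[X in X * x `^ _](powRr1 (ltW x0)) -powRD ?nz ?implybT//.
  rewrite -powR_mulrn ?powR_ge0// -powRrM -powRD ?nz ?implybT//.
  by rewrite -[leRHS](powRr0 x); apply: ler_powR => //; rewrite /s; lra.
have -> : x `^ s * (delta ^+ 2 * (r * x `^ (- alpha)) + (x * delta ^+ 2) ^+ 2) =
    e ^+ 2 * r * (x `^ s * (x `^ (- (2 * beta)) * x `^ (- alpha))) +
    e ^+ 4 * (x `^ s * (x * x `^ (- (2 * beta))) ^+ 2) by rewrite d2; ring.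
by rewrite E1 mulr1 lerD2l ler_piMr// exprn_ge0.
Qed.

(** The factor [x * delta^2] is [e^2 * x^(1 - 2 beta)], decreasing in [x] because 2 beta > 1. The
    upper bound on the dimension therefore bounds it below, and the powers of [y] cancel. *)
Lemma rate_lower_bound (R : realType) (alpha beta e x y : R) :
  0 < alpha + 2 * beta -> 1 < 2 * beta -> 0 < x -> 0 < y ->
  x <= 2 * y `^ (alpha + 2 * beta)^-1 ->
  e ^+ 2 * 2 `^ (1 - 2 * beta) <=
    y `^ ((2 * beta - 1) / (alpha + 2 * beta)) * (x * (e * x `^ (- beta)) ^+ 2).
Proof.
set s := alpha + 2 * beta => s0 b1 x0 y0 xy.
have xe : x * (e * x `^ (- beta)) ^+ 2 = e ^+ 2 * x `^ (1 - 2 * beta).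
  have nz : x != 0 by rewrite gt_eqF.
  rewrite exprMn -[(x `^ _) ^+ 2]powR_mulrn ?powR_ge0// -powRrM mulrCA.
  congr (_ * _); rewrite -[X in X * _](powRr1 (ltW x0)) -powRD ?nz ?implybT//.
  by congr (_ `^ _); ring.
have low : (2 * y `^ s^-1) `^ (1 - 2 * beta) <= x `^ (1 - 2 * beta).
  have -> : 1 - 2 * beta = - (2 * beta - 1) by ring.
  rewrite !powRN lef_pV2 ?posrE ?powR_gt0 ?mulr_gt0 ?powR_gt0//.
  apply: ge0_ler_powR => //; rewrite ?nnegrE ?mulr_ge0 ?powR_ge0 ?(ltW x0)//.
  by rewrite subr_ge0 ltW.
have E : y `^ ((2 * beta - 1) / s) * (2 * y `^ s^-1) `^ (1 - 2 * beta) = 2 `^ (1 - 2 * beta).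
  have nz : y != 0 by rewrite gt_eqF.
  rewrite powRM ?powR_ge0// -powRrM mulrCA -powRD ?nz ?implybT//.
  rewrite (_ : (2 * beta - 1) / s + s^-1 * (1 - 2 * beta) = 0) ?powRr0 ?mulr1//.
  rewrite [s^-1 * _]mulrC -mulrDl (_ : 2 * beta - 1 + (1 - 2 * beta) = 0) ?mul0r//; ring.
by rewrite xe mulrCA -E ler_wpM2l ?sqr_ge0// ler_wpM2l ?powR_ge0.
Qed.

Theorem theorem2 (R : realType)
  (Q : R -> probability (measurableTypeR R) R) (psi : R -> R) (G : R -> R)
  (alpha beta r : R)
  (Gamma : L2 R -> (measurableTypeR R * measurableTypeR R -> R) ->
           probability (L2 R) R)
  (PP : forall n : nat, param R -> probability (n.-tuple (obs R)) R)
  (Bhat : forall n : nat, n.-tuple (obs R) -> L2 R)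
  (hQ : exponential_family Q psi)
  (hpsi2 : forall lam : R, 0 < derive1n 2 psi lam)
  (hpsi_growth : forall eps : R, 0 < eps -> exists C : R,
     forall lam : R, derive1n 2 psi lam <= C * expR (eps * lam ^+ 2))
  (hG_incr : forall x y : R, 0 <= x -> x <= y -> G x <= G y)
  (hG0 : 1 <= G 0)
  (hpsi3 : forall lam h : R, `|derive1n 3 psi (lam + h)| <= derive1n 2 psi lam * G `|h|)
  (halpha : 1 < alpha)
  (hbeta : (alpha + 3) / 2 < beta)
  (hr : 0 < r)
  (hF : paramF r alpha beta !=set0)
  (hGamma : forall f : param R, paramF r alpha beta f ->
     gaussian_process_law (Gamma (pmu f) (pK f)) (pmu f) (pK f))
  (hPP : forall (n : nat) (f : param R), paramF r alpha beta f ->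
     sample_law Q (Gamma (pmu f) (pK f)) (pa f) (pB f) (PP n f))
  (hBhat : forall n : nat, measurable_fun [set: n.-tuple (obs R)] (Bhat n)) :
  (0 < limn_einf (fun n : nat =>
     (n%:R `^ ((2 * beta - 1) / (alpha + 2 * beta)))%:E *
     ereal_sup [set 'E_(PP n f)[fun z => (norm01 (pB f \- Bhat n z) ^+ 2)%R]
               | f in paramF r alpha beta]))%E.
Proof.
case: hF => f0 [theta [phi [b0 [[cK [KL [on [ee [th1 th2]]]]] _]]]].
set K := pK f0 in cK KL ee.
have beta0 : 0 <= beta by lra.
pose s := alpha + 2 * beta.
have s0 : 0 < s by rewrite /s; lra.
have ab : alpha + 2 <= 2 * beta by lra.
have a0 : 0 < alpha by lra.
have b1 : 1 < 2 * beta by lra.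
have cubeF m delta (g : {ffun 'I_m -> bool}) : 0 <= delta -> delta <= r * (2 * m)%:R `^ (- beta) ->
    paramF r alpha beta (Param K 0 0 (cube phi delta g)).
  by move=> d0 dle; exact: (cube_paramF on g hr beta0 d0 dle cK KL ee th1 th2).
(* The cube of dimension 0 provides the base point with slope zero. It shares mean 0 and kernel [K]
   with all cube points, so the law of the covariate is the same [Gamma 0 K] throughout. *)
have f00 : paramF r alpha beta (Param K 0 0 0).
  have := cubeF 0%N 0 [ffun=> true] (lexx 0).
  rewrite /cube big_ord0; apply.
  by rewrite mulr_ge0 ?powR_ge0// ltW.
have hG := hGamma _ f00; rewrite /= in hG.
have [C C0 HC] := obs_affinity_ge hQ hG KL on ee.
have th0 k : 0 <= theta k.
  have [C1 _ [_ sqr]] := gaussian_law_bounds hG KL on ee.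
  by rewrite -lee_fin -sqr; apply: integral_ge0 => x _; rewrite lee_fin sqr_ge0.
have u0 : 0 < r * 2 `^ (- beta) by rewrite mulr_gt0// powR_gt0.
have [e e0 [er eC]] := radius_choice C0 hr u0.
(* The constant of [rate_lower_bound] times the 1/32 of [assouad]; it bounds every term with
   [n >= 1]. *)
pose c := e ^+ 2 * 2 `^ (1 - 2 * beta) / 32.
have c0 : 0 < c by rewrite divr_gt0// mulr_gt0 ?exprn_gt0 ?powR_gt0.
apply: (@lt_le_trans _ _ c%:E); first by rewrite lte_fin.
apply: (@limn_einf_ge _ _ _ 1%N) => n n1.
have [m m0 [nm mx]] := dimension_choice s0 n1.
have M0 : 0 < m%:R :> R by rewrite ltr0n.
pose delta := e * m%:R `^ (- beta).
have d0 : 0 < delta by rewrite mulr_gt0// powR_gt0.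
have dle : delta <= r * (2 * m)%:R `^ (- beta).
  by rewrite natrM powRM// mulrA ler_pM2r ?powR_gt0.
set S := ereal_sup _.
have cS : ((m%:R * delta ^+ 2 / 32)%:E <= S)%E.
  apply: (@assouad _ Q psi hQ (Gamma 0 K) n (PP n (Param K 0 0 0)) phi m delta
    (hPP n _ f00) on (fun g => PP n (Param K 0 0 (cube phi delta g))) _ (Bhat n) (hBhat n)).
  - by move=> g; exact: (hPP n _ (cubeF m delta g (ltW d0) dle)).
  - move=> g i gi.
    pose b := m%:R * delta ^+ 2.
    have b0' : 0 < b by rewrite mulr_gt0// exprn_gt0.
    have [a aE age] := HC _ _ b delta (m + i)%N b0' (ip01_cube_le _ on g)
      (ip01_cube_le _ on (flip i g)) (fun x => ip01_cube_flip phi delta x gi).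
    exists a => //.
    set t := C * _ in age.
    have t0 : 0 <= t.
      by rewrite mulr_ge0 ?(ltW C0)// addr_ge0 ?sqr_ge0// mulr_ge0 ?sqr_ge0.
    (* Replace [n] by the larger m^s and theta_(m+i) by its bound r m^-alpha; [perturbation_budget]
       then removes [m], and the choice of [e] concludes. *)
    have nt : n%:R * t <= 1 / 4.
      have m1 : 1 <= m%:R :> R by rewrite ler1n.
      apply: le_trans eC; rewrite /t mulrCA ler_pM2l//.
      apply: le_trans (perturbation_budget r ab m1 (ltW e0)).
      apply: ler_pM => //.
        by rewrite addr_ge0 ?sqr_ge0// mulr_ge0 ?sqr_ge0.
      rewrite lerD2r ler_wpM2l ?sqr_ge0// (le_trans (th1 _))// ler_pM2l//.
      rewrite !powRN lef_pV2 ?posrE ?powR_gt0 ?ltr0n//.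
      apply: ge0_ler_powR; rewrite ?nnegrE ?ler0n ?(ltW a0)//.
      by rewrite ler_nat (leq_trans (leq_addr i m)).
    have nt1 : 3 / 4 <= 1 - n%:R * t by rewrite lerBrDl -lerBrDr (le_trans nt)// ler_pdivrMr//; lra.
    have t1 : t <= 1.
      rewrite (@le_trans _ _ (n%:R * t))//; first by rewrite ler_peMl// ler1n.
      by rewrite (le_trans nt)// ler_pdivrMr// mul1r ler1n.
    (* Bernoulli's inequality: [a ^+ n >= (1 - t) ^+ n >= 1 - n * t >= 3 / 4]. *)
    apply: (le_trans nt1); apply: le_trans (bernoulli_ge n t0 t1) _.
    by apply: lerXn2r; rewrite ?nnegrE ?subr_ge0// (le_trans _ age)// subr_ge0.
  - move=> g; apply: ereal_sup_ubound.
    by exists (Param K 0 0 (cube phi delta g)) => //; exact: cubeF (ltW d0) dle.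
apply: (@le_trans _ _ ((n%:R `^ ((2 * beta - 1) / s))%:E * (m%:R * delta ^+ 2 / 32)%:E)%E); last first.
  by apply: lee_wpmul2l => //; rewrite lee_fin powR_ge0.
rewrite -EFinM lee_fin mulrA ler_pM2r ?invr_gt0//.
by apply: rate_lower_bound; rewrite ?ltr0n.
Qed.
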